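(* The homomorphism $\theta:(\mathfrak{H}^0,* )\to\mathbb{R}$ (with $\theta(1)=1$, $\theta(z_{i_1}\cdots z_{i_k})=t(i_1,\dots,i_k)$ for $i_1>1$) can be extended to an algebra homomorphism $\theta:(\mathfrak{H}^1,* )\to\mathbb{R}$ such that, as formal power series in $x$, \[ \sum_{n\ge 0}\theta(h_n)x^n=\pi^{-1/2}e^{-\gamma x/2}\,\Gamma\!\left(\frac{1-x}{2}\right), \] where $\gamma$ is Euler's constant and the right-hand side is expanded as a power series in $x$ about $0$.
   Context: $\mathfrak{H}^1$ is the $\mathbb{Q}$-vector space with basis the words (including the empty word $1$) in noncommuting letters $z_1,z_2,\dots$, with commutative product $*$ defined by $w*1=1*w=w$ and $z_iw_1*z_jw_2=z_i(w_1*z_jw_2)+z_j(z_iw_1*w_2)+z_{i+j}(w_1*w_2)$; $\mathfrak{H}^0$ is the subalgebra spanned by $1$ and words beginning with $z_i$, $i>1$. Multiple $t$-values: $t(i_1,\dots,i_k)=\sum_{n_1>\cdots>n_k\ge1,\ n_j\text{ odd}}n_1^{-i_1}\cdots n_k^{-i_k}$ for $i_1\ge2$. The element $h_n\in\mathfrak{H}^1$ ($n\ge1$) is the sum of all words $z_{n_1}\cdots z_{n_p}$ with $n_1+\cdots+n_p=n$ (it corresponds to the complete symmetric function under the isomorphism of $(\mathfrak{H}^1,* )$ with quasi-symmetric functions sending $z_{n_1}\cdots z_{n_p}$ to the monomial quasi-symmetric function $M_{n_1,\dots,n_p}$), and $h_0=1$. *)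

(* Defs.v *)
From HB Require Import structures.
From mathcomp Require Import all_boot all_order all_algebra.
From mathcomp Require Import all_classical all_reals all_analysis.
From mathcomp Require Import freeg.

Set Implicit Arguments.
Unset Strict Implicit.
Unset Printing Implicit Defensive.

Import Order.TTheory GRing.Theory Num.Theory.
Import numFieldNormedType.Exports.

Local Open Scope ring_scope.

(* The letter z_i is represented by its index i >= 1. *)
Definition letter : Type := {i : nat | (0 < i)%N}.

HB.instance Definition _ := Choice.on letter.

Lemma letter_add_gt0 (i j : letter) : (0 < val i + val j)%N.
Proof. by rewrite addn_gt0 (valP i). Qed.

Definition letter_add (i j : letter) : letter :=
  exist _ (val i + val j)%N (letter_add_gt0 i j).

Definition letterS (m : nat) : letter := exist _ m.+1 (ltn0Sn m).

Definition word : Type := seq letter.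

HB.instance Definition _ := Choice.on word.

Definition H1 : Type := {freeg word / rat}.

HB.instance Definition _ := GRing.Lmodule.on H1.

Definition of_word (w : word) : H1 := << w >>.

(* [fglift f] is the linear extension to H1 of a function f on words. *)
Definition prepend (i : letter) : H1 -> H1 :=
  fglift (fun w : word => of_word (i :: w)).

Fixpoint word_mul (u v : word) {struct u} : H1 :=
  let fix aux (v : word) : H1 :=
    match u, v with
    | [::], _ => of_word v
    | _, [::] => of_word u
    | i :: u', j :: v' =>
        prepend i (word_mul u' v) + prepend j (aux v')
        + prepend (letter_add i j) (word_mul u' v')
    end
  in aux v.

Definition quasi_mul (a b : H1) : H1 :=
  fglift (fun u : word => fglift (word_mul u) b : H1) a.

Lemma word_mul_nil_l v : word_mul [::] v = of_word v.
Proof. by case: v. Qed.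

Lemma word_mul_nil_r u : word_mul u [::] = of_word u.
Proof. by case: u. Qed.

Lemma word_mul_cons i u j v :
  word_mul (i :: u) (j :: v) =
    prepend i (word_mul u (j :: v)) + prepend j (word_mul (i :: u) v)
    + prepend (letter_add i j) (word_mul u v).
Proof. by []. Qed.

Section LinearExtension.
Variables (V : lmodType rat) (f : word -> V).

Lemma fglift_of_word w : fglift f (of_word w) = f w.
Proof. by rewrite liftU scale1r. Qed.

Lemma fgliftB (a b : H1) : fglift f (a - b) = fglift f a - fglift f b.
Proof. exact: lift_is_additive. Qed.

Lemma fglift0 : fglift f (0 : H1) = 0.
Proof. by rewrite -(subr0 (0 : H1)) fgliftB subrr. Qed.

Lemma fgliftD (a b : H1) : fglift f (a + b) = fglift f a + fglift f b.
Proof. by apply: (addIr (- fglift f b)); rewrite -fgliftB !addrK. Qed.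

Lemma fgliftE (a : H1) : fglift f a = \sum_(w <- dom a) coeff w a *: f w.
Proof.
rewrite -{1}[a]freeg_sumE (big_morph _ fgliftD fglift0).
by apply: eq_bigr => w _; rewrite liftU.
Qed.

Lemma fgliftZ k (a : H1) : fglift f (k *: a) = k *: fglift f a.
Proof.
rewrite [in RHS]fgliftE scaler_sumr (big_morph _ fgliftD fglift0).
by apply: eq_bigr => w _; rewrite liftU scalerA.
Qed.

End LinearExtension.

Lemma H1_ind (P : H1 -> Prop) :
  P 0 -> (forall k w a, P a -> P (k *: of_word w + a)) -> forall a, P a.
Proof.
move=> P0 PS a; rewrite -[a]freeg_sumE.
elim: (dom a) => [|w s IHs]; first by rewrite big_nil.
rewrite big_cons; set c := coeff w a.
have -> : << c *g w >> = c *: of_word w.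
  by apply/eqP/freeg_eqP => v; rewrite coeffZ !coeffU mul1r.
exact: PS.
Qed.

Lemma prependD i : {morph prepend i : a b / a + b}.
Proof. exact: fgliftD. Qed.

Lemma prependZ i k a : prepend i (k *: a) = k *: prepend i a.
Proof. exact: fgliftZ. Qed.

Lemma prepend0 i : prepend i 0 = 0.
Proof. exact: fglift0. Qed.

Lemma prepend_word i w : prepend i (of_word w) = of_word (i :: w).
Proof. exact: fglift_of_word. Qed.

Lemma quasi_mul_word u v : quasi_mul (of_word u) (of_word v) = word_mul u v.
Proof. by rewrite /quasi_mul !fglift_of_word. Qed.

Lemma quasi_mulDl a b c :
  quasi_mul (a + b) c = quasi_mul a c + quasi_mul b c.
Proof. exact: fgliftD. Qed.

Lemma quasi_mulZl k a b : quasi_mul (k *: a) b = k *: quasi_mul a b.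
Proof. exact: fgliftZ. Qed.

Lemma quasi_mul0l a : quasi_mul 0 a = 0.
Proof. exact: fglift0. Qed.

Lemma quasi_mulDr a b c :
  quasi_mul a (b + c) = quasi_mul a b + quasi_mul a c.
Proof.
rewrite /quasi_mul !fgliftE -big_split /=; apply: eq_bigr => w _.
by rewrite fgliftD scalerDr.
Qed.

Lemma quasi_mulZr k a b : quasi_mul a (k *: b) = k *: quasi_mul a b.
Proof.
rewrite /quasi_mul !fgliftE scaler_sumr /=; apply: eq_bigr => w _.
by rewrite fgliftZ !scalerA mulrC.
Qed.

Lemma quasi_mul0r a : quasi_mul a 0 = 0.
Proof. by rewrite -(scale0r (0 : H1)) quasi_mulZr !scale0r. Qed.

Lemma letter_addC : commutative letter_add.
Proof. by move=> i j; apply: val_inj; rewrite /= addnC. Qed.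

Lemma letter_addA : associative letter_add.
Proof. by move=> i j k; apply: val_inj; rewrite /= addnA. Qed.

Lemma quasi_mul1l : left_id (of_word [::]) quasi_mul.
Proof.
elim/H1_ind => [|k w a IHa]; first by rewrite quasi_mul0r.
by rewrite quasi_mulDr quasi_mulZr quasi_mul_word word_mul_nil_l IHa.
Qed.

Lemma word_mulC u v : word_mul u v = word_mul v u.
Proof.
elim: u v => [|i u IHu] v; first by rewrite word_mul_nil_l word_mul_nil_r.
elim: v => [|j v IHv]; first by rewrite word_mul_nil_l word_mul_nil_r.
rewrite !word_mul_cons IHu IHv [word_mul u v]IHu letter_addC.
by congr (_ + _); rewrite addrC.
Qed.

Lemma quasi_mulC : commutative quasi_mul.
Proof.
elim/H1_ind => [|k u a IHa] b; first by rewrite quasi_mul0l quasi_mul0r.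
rewrite quasi_mulDl quasi_mulDr quasi_mulZl quasi_mulZr IHa.
congr (k *: _ + _).
elim/H1_ind: b => [|l v b IHb]; first by rewrite quasi_mul0l quasi_mul0r.
rewrite quasi_mulDl quasi_mulDr quasi_mulZl quasi_mulZr IHb.
by rewrite !quasi_mul_word word_mulC.
Qed.

Lemma quasi_mul1r : right_id (of_word [::]) quasi_mul.
Proof. by move=> a; rewrite quasi_mulC quasi_mul1l. Qed.

Lemma linear_add3 (k : rat) (a1 a2 b1 b2 c1 c2 : H1) :
  k *: a1 + a2 + (k *: b1 + b2) + (k *: c1 + c2) =
    k *: (a1 + b1 + c1) + (a2 + b2 + c2).
Proof. by rewrite !scalerDr [X in X + _]addrACA [LHS]addrACA. Qed.

Lemma quasi_mul_prepend i a j b :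
  quasi_mul (prepend i a) (prepend j b) =
    prepend i (quasi_mul a (prepend j b)) + prepend j (quasi_mul (prepend i a) b)
    + prepend (letter_add i j) (quasi_mul a b).
Proof.
elim/H1_ind: a => [|k u a IHa].
  by rewrite !(prepend0, quasi_mul0l) !addr0.
rewrite !(prependD, prependZ, quasi_mulDl, quasi_mulZl) linear_add3 IHa.
congr (k *: _ + _); elim/H1_ind: b {IHa} => [|l v b IHb].
  by rewrite !(prepend0, quasi_mul0r) !addr0.
rewrite !(prependD, prependZ, quasi_mulDr, quasi_mulZr) linear_add3 IHb.
by congr (l *: _ + _); rewrite !prepend_word !quasi_mul_word.
Qed.

Lemma addr_regroup9 (a1 a2 a3 k1 k2 k3 b c e f g A K : H1) :
  a1 + a2 + a3 = A -> k1 + k2 + k3 = K ->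
  a1 + b + c + (a2 + K + e) + (a3 + f + g) =
  A + k1 + e + (b + k2 + f) + (c + k3 + g).
Proof.
move=> <- <-; rewrite !addrA.
by rewrite [LHS](ACl (1*4*9*5*8*2*6*10*3*7*11)%AC).
Qed.

Lemma quasi_mulA_word u v w :
  quasi_mul (of_word u) (quasi_mul (of_word v) (of_word w)) =
  quasi_mul (quasi_mul (of_word u) (of_word v)) (of_word w).
Proof.
have [n] := ubnP (size u + size v + size w)%N.
elim: n u v w => // n IHn [|i u] [|j v] [|k w];
  rewrite ?(quasi_mul1l, quasi_mul1r) // => le_n.
rewrite -!prepend_word.
rewrite [quasi_mul (prepend j _) _]quasi_mul_prepend.
rewrite [quasi_mul (prepend i _) (prepend j _)]quasi_mul_prepend.
rewrite !quasi_mulDr !quasi_mulDl !quasi_mul_prepend letter_addA.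
have IH u' v' w' :
    (size u' + size v' + size w' < (size u + size v + size w).+3)%N ->
    quasi_mul (of_word u') (quasi_mul (of_word v') (of_word w')) =
    quasi_mul (quasi_mul (of_word u') (of_word v')) (of_word w').
  move=> lt; apply: IHn; apply: leq_trans lt _.
  by move: le_n => /=; rewrite !(addSn, addnS) ltnS.
rewrite !prepend_word (IH (i :: u) v (k :: w)) ?(IH u v (k :: w))
  ?(IH u (j :: v) w) ?(IH (i :: u) v w) ?(IH u v w);
  try by rewrite /= ?(addSn, addnS) ?ltnS ?leqW.
apply: addr_regroup9.
  rewrite -!prependD -!quasi_mulDr -!prepend_word -quasi_mul_prepend.
  by rewrite !prepend_word IH //= !(addSn, addnS).
rewrite -!prependD -!quasi_mulDl -!prepend_word -quasi_mul_prepend.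
by rewrite !prepend_word IH //= !(addSn, addnS).
Qed.

Lemma quasi_mulA : associative quasi_mul.
Proof.
elim/H1_ind => [|k u a IHa] b c; first by rewrite !quasi_mul0l.
rewrite !(quasi_mulDl, quasi_mulZl) IHa; congr (k *: _ + _).
elim/H1_ind: b {IHa} => [|l v b IHb]; first by rewrite !(quasi_mul0l, quasi_mul0r).
rewrite !(quasi_mulDl, quasi_mulZl, quasi_mulDr, quasi_mulZr) IHb.
congr (l *: _ + _).
elim/H1_ind: c {IHb} => [|m w c IHc]; first by rewrite !quasi_mul0r.
by rewrite !(quasi_mulDr, quasi_mulZr) IHc quasi_mulA_word.
Qed.

Lemma of_word_nil_neq0 : of_word [::] != 0.
Proof. by rewrite freegU_eq0. Qed.

HB.instance Definition _ := GRing.Zmodule_isComNzRing.Build H1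
  quasi_mulA quasi_mulC quasi_mul1l quasi_mulDl of_word_nil_neq0.

HB.instance Definition _ := GRing.Lmodule_isLalgebra.Build rat H1
  (fun k a b => esym (quasi_mulZl k a b)).

HB.instance Definition _ := GRing.Lalgebra_isComAlgebra.Build rat H1.

Lemma mulH1_word u v : of_word u * of_word v = word_mul u v.
Proof. exact: quasi_mul_word. Qed.

Definition admissible (w : word) : bool :=
  if w is i :: _ then (1 < val i)%N else true.

Definition H0 : {pred H1} := fun a => all admissible (dom (a : H1)).

Lemma H0P (a : H1) :
  reflect (forall w, coeff w a != 0 -> admissible w) (a \in H0).
Proof.
by apply: (iffP allP) => adm w; have := adm w; rewrite mem_dom.
Qed.

Lemma H0_word w : (of_word w \in H0) = admissible w.
Proof. by rewrite unfold_in /= domU1 /= andbT. Qed.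

Lemma H0_linear : linear_closed H0.
Proof.
move=> k a b /H0P H0a /H0P H0b; apply/H0P => w.
rewrite coeffD coeffZ; have [a0|/H0a //] := eqVneq (coeff w a) 0.
by rewrite a0 mulr0 add0r => /H0b.
Qed.

Lemma H0_0 : 0 \in H0.
Proof. by apply/H0P => w; rewrite coeff0 eqxx. Qed.

Lemma H0_scale k a : a \in H0 -> k *: a \in H0.
Proof. by move=> H0a; rewrite -[_ *: _]addr0 H0_linear // H0_0. Qed.

Lemma H0_add a b : a \in H0 -> b \in H0 -> a + b \in H0.
Proof. by move=> H0a; rewrite -[a]scale1r; apply: H0_linear. Qed.

Lemma H0_fglift (f : word -> H1) (a : H1) :
  (forall w, w \in dom a -> f w \in H0) -> fglift f a \in H0.
Proof.
move=> H0f; rewrite fgliftE big_seq.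
by elim/big_ind: _ => [|x y|w /H0f]; [exact: H0_0|exact: H0_add|exact: H0_scale].
Qed.

Lemma H0_prepend (i : letter) a : (1 < val i)%N -> prepend i a \in H0.
Proof. by move=> i1; apply: H0_fglift => w _; rewrite H0_word. Qed.

Lemma H0_word_mul u v : admissible u -> admissible v -> word_mul u v \in H0.
Proof.
case: u v => [|i u] [|j v]; rewrite ?word_mul_nil_l ?word_mul_nil_r ?H0_word //.
move=> i1 j1; rewrite word_mul_cons !H0_add ?H0_prepend //=.
by rewrite ltn_addr.
Qed.

Lemma H0_subalg : subalg_closed H0.
Proof.
split=> [||a b /allP H0a /allP H0b]; [by rewrite H0_word|exact: H0_linear|].
by do 2?apply: H0_fglift => ? ?; apply: H0_word_mul; [exact: H0a|exact: H0b].
Qed.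

HB.instance Definition _ := GRing.isSubalgClosed.Build rat H1 H0 H0_subalg.

(* The parts of a composition of n into p parts are written i.+1 with i < n;
   for n = 0 only the empty word remains, so that h 0 = 1. *)
Definition h (n : nat) : H1 :=
  \sum_(p < n.+1) \sum_(s : p.-tuple 'I_n | (\sum_(i <- s) i.+1)%N == n)
    of_word [seq letterS (nat_of_ord i) | i <- s].

Lemma h0 : h 0 = 1.
Proof.
rewrite /h big_ord1 (big_pred1 [tuple]) // => s.
by rewrite [s]tuple0 [RHS]/= eqxx big_nil.
Qed.

Local Open Scope classical_set_scope.

Section Analytic.
Variable R : realType.

(* The sum is unordered in \bar R; it is finite for admissible w. *)
Definition mtv (w : word) : R :=
  fine (\esum_(n in [set n : (size w).-tuple nat | sorted gtn n /\ all odd n])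
          (\prod_(j < size w)
             (tnth n j)%:R ^- val (tnth (in_tuple w) j))%:E)%E.

Definition theta0 (a : H1) : R :=
  \sum_(w <- dom a) ratr (coeff w a) * mtv w.

(* Euler's integral, meaningful for 0 < s. *)
Definition Gamma (s : R) : R :=
  \int[lebesgue_measure]_(t in `]0%R, +oo[) (t `^ (s - 1) * expR (- t)).

Definition euler_gamma : R :=
  limn (fun n => series harmonic n - ln n%:R : R).

Definition power_series_at0 (f : R -> R) (a : nat -> R) : Prop :=
  \forall x \near 0, series (fun n => a n * x ^+ n) @ \oo --> f x.

End Analytic.

(* Main.v *)
(* The truncated sums [trunc N] (all indices at most N) are homomorphisms on the
   whole quasi-shuffle algebra H1 and converge to the multiple t-values on
   admissible words, so theta is multiplicative on H0.  Since z_1 * w equals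
   (k + 1) z_1 w plus words with at most k leading letters z_1, where k is the
   number of leading z_1 in w, the algebra H1 is generated by H0 and z_1, and a
   homomorphism on H0 extends to H1 with any prescribed value at z_1; here the
   value is ln 2.

   By Newton's identity n h_n = sum_k z_k * h_(n-k), the numbers theta (h_n) are
   determined by the power sums theta (z_k).  They are the limits of the numbers
   attached in the same way to the extension of [trunc (2 * N)] with
   z_1 |-> sum_(j < N) 1 / (2 j + 1) - (ln N + gamma) / 2, which tends to ln 2.
   The generating function of the latter is
   exp (- (ln N + gamma) x / 2) * prod_(j < N) (1 - x / (2 j + 1))^-1,
   and Gauss's limit for the Gamma function at (1 - x) / 2 and 1 / 2, together
   with Gamma (1 / 2) = sqrt pi, identifies its limit. *)
Require Import Defs.
From HB Require Import structures.
From mathcomp Require Import all_boot all_order all_algebra.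
From mathcomp Require Import all_classical all_reals all_analysis.
From mathcomp Require Import freeg measurable_realfun.
From mathcomp Require Import zify ring lra.

Set Implicit Arguments.
Unset Strict Implicit.
Unset Printing Implicit Defensive.

Import Order.TTheory GRing.Theory Num.Theory.
Import numFieldNormedType.Exports.

Local Open Scope ring_scope.

(** * Newton's identity *)

(** The alphabet bound [m] is kept apart from the weight [n], so that it stays fixed when removing
    the first letter lowers the weight. *)
Definition sum_words (m p n : nat) : H1 :=
  \sum_(s : p.-tuple 'I_m | (\sum_(i <- s) i.+1)%N == n)
    of_word [seq letterS (nat_of_ord i) | i <- s].

Fixpoint h_len (p n : nat) : H1 :=
  if p is p'.+1 then \sum_(j < n) prepend (letterS j) (h_len p' (n - j.+1))
  else if n == 0%N then 1 else 0.

Lemma prepend_sum i (I : Type) (r : seq I) (P : pred I) (F : I -> H1) :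
  prepend i (\sum_(k <- r | P k) F k) = \sum_(k <- r | P k) prepend i (F k).
Proof. exact: (big_morph _ (prependD i) (prepend0 i)). Qed.

Lemma prependMn i a n : prepend i (a *+ n) = prepend i a *+ n.
Proof. by rewrite -[n]card_ord -!sumr_const prepend_sum. Qed.

Lemma sum_wordsE m p n : (n <= m)%N -> sum_words m p n = h_len p n.
Proof.
elim: p n => [|p IHp] n le_nm.
  rewrite /sum_words /= eq_sym.
  rewrite (eq_bigl (fun=> 0%N == n)) => [|s]; last by rewrite [s]tuple0 big_nil.
  case: eqP => _; last by rewrite big_pred0.
  by rewrite (big_pred1 [tuple]) // => s; rewrite [s]tuple0 /= eqxx.
rewrite /sum_words /=.
rewrite (reindex (fun x : 'I_m * p.-tuple 'I_m => cons_tuple x.1 x.2)) /=; last first.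
  exists (fun t => (thead t, behead_tuple t)) => [[i s] _|t _] /=.
    by congr (_, _); apply: val_inj.
  by rewrite [RHS]tuple_eta; apply: val_inj.
rewrite (eq_bigl (fun x : 'I_m * p.-tuple 'I_m => (x.1 < n)%N &&
   ((\sum_(i <- x.2) i.+1)%N == n - x.1.+1)%N)); last first.
  move=> [i s] /=; rewrite big_cons; apply/eqP/andP => [<-|[lt_in /eqP->]].
    by rewrite addnC addnK addnS ltnS leq_addl.
  by rewrite addnC subnK.
rewrite -(pair_big_dep (fun i : 'I_m => (i < n)%N)
  (fun (i : 'I_m) (s : p.-tuple 'I_m) => (\sum_(i <- s) i.+1)%N == n - i.+1)%N
  (fun i (s : p.-tuple 'I_m) => of_word [seq letterS (nat_of_ord k) | k <- i :: s])) /=.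
rewrite (big_ord_widen_cond m (fun=> true) (fun j => prepend (letterS j) (h_len p (n - j.+1)))) //.
apply: eq_bigr => i lt_in.
rewrite -IHp; last by rewrite (leq_trans (leq_subr _ _)).
rewrite prepend_sum; apply: eq_bigr => s _; exact/esym/prepend_word.
Qed.

Lemma h_len_gt p n : (n < p)%N -> h_len p n = 0.
Proof.
elim: p n => // p IHp n lt_np /=; apply: big1 => j _.
by rewrite IHp ?prepend0 // subnS prednK ?subn_gt0 //; lia.
Qed.

Lemma h_lenE n : h n = \sum_(p < n.+1) h_len p n.
Proof. by apply: eq_bigr => p _; rewrite -(@sum_wordsE n). Qed.

Lemma hS n : h n.+1 = \sum_(j < n.+1) prepend (letterS j) (h (n - j)).
Proof.
rewrite h_lenE big_ord_recl /= add0r exchange_big; apply: eq_bigr => j _.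
rewrite -prepend_sum h_lenE; congr prepend.
rewrite [RHS](big_ord_widen_cond n.+1 xpredT (fun p => h_len p (n - j))) ?ltnS ?leq_subr //.
rewrite [RHS]big_mkcond /=; apply: eq_bigr => p _; rewrite subSS.
by case: ltnP => // ?; rewrite h_len_gt.
Qed.

Lemma card_ord_lt n (s : 'I_n) : #|[pred k : 'I_n | (k < s)%N]| = s.
Proof.
rewrite -sum1_card -(big_ord_widen n (fun=> 1%N)) ?sum1_card ?card_ord //.
exact: ltnW.
Qed.

Lemma letter_addS j k : letter_add (letterS k) (letterS j) = letterS (k + j).+1.
Proof. by apply: val_inj; rewrite /= addSn addnS. Qed.

(** The three terms of the quasi-shuffle recursion: the single letter comes first, the first letter
    of [h m] comes first, or the two merge. *)
Lemma letter_mul_h k m :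
  of_word [:: letterS k] * h m = prepend (letterS k) (h m)
    + \sum_(j < m) prepend (letterS j) (of_word [:: letterS k] * h (m - j.+1))
    + \sum_(j < m) prepend (letterS (k + j).+1) (h (m - j.+1)).
Proof.
case: m => [|m]; first by rewrite !big_ord0 !addr0 h0 mulr1 -prepend_word.
rewrite {1 2}hS prepend_sum mulr_sumr -!big_split /=; apply: eq_bigr => j _.
have -> : of_word [:: letterS k] = prepend (letterS k) 1 by rewrite prepend_word.
have -> : @GRing.mul H1 = quasi_mul by [].
by rewrite quasi_mul_prepend quasi_mul1l letter_addS subSS quasi_mul1l.
Qed.

(** Sort the right-hand side, in weight n + 1, by its first letter z_(j+1): each word occurs once
    with the single letter in front, n - j times by induction and j times through a merger, in total
    n + 1 times. *)
Lemma newton_h n :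
  h n *+ n = \sum_(k < n) of_word [:: letterS k] * h (n - k.+1).
Proof.
elim/ltn_ind: n => -[_|n IHn]; first by rewrite big_ord0.
under eq_bigr do rewrite subSS letter_mul_h.
rewrite !big_split /= -hS.
have -> : \sum_(k < n.+1) \sum_(j < n - k)
      prepend (letterS j) (of_word [:: letterS k] * h (n - k - j.+1)) =
    \sum_(j < n.+1) prepend (letterS j) (h (n - j)) *+ (n - j).
  transitivity (\sum_(k < n.+1) \sum_(j < n.+1 | (k + j < n)%N)
      prepend (letterS j) (of_word [:: letterS k] * h (n - k - j.+1))).
    apply: eq_bigr => k _.
    rewrite (big_ord_widen n.+1 (fun j => prepend (letterS j)
      (of_word [:: letterS k] * h (n - k - j.+1)))) ?leqW ?leq_subr //.
    by apply: eq_bigl => j; rewrite ltn_subRL.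
  rewrite (exchange_big_dep xpredT) //=; apply: eq_bigr => j _.
  rewrite -prependMn IHn ?ltnS ?leq_subr // prepend_sum.
  rewrite (big_ord_widen n.+1 (fun k => prepend (letterS j)
    (of_word [:: letterS k] * h (n - j - k.+1)))) ?leqW ?leq_subr //.
  apply: eq_big => [k|k _]; first by rewrite ltn_subRL addnC.
  by congr (prepend _ (_ * h _)); lia.
(* The letter z_(s+1) is the merger of z_(k+1) and z_(s-k) for each k < s, hence the multiplicity
   s. *)
have -> : \sum_(k < n.+1) \sum_(j < n - k)
      prepend (letterS (k + j).+1) (h (n - k - j.+1)) =
    \sum_(s < n.+1) prepend (letterS s) (h (n - s)) *+ s.
  transitivity (\sum_(k < n.+1) \sum_(s < n.+1 | (k < s)%N)
      prepend (letterS s) (h (n - s))).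
    apply: eq_bigr => k _.
    rewrite -(big_mkord (fun s => k < s)%N (fun s => prepend (letterS s) (h (n - s)))).
    rewrite (big_cat_nat (n := k.+1)) //=.
    rewrite [X in X + _]big_nat_cond [X in X + _]big_pred0 ?add0r; last by move=> i; lia.
    rewrite big_nat_cond (eq_bigl (fun i => (k < i < n.+1)%N && true)); last by move=> i /=; lia.
    rewrite -big_nat_cond -{1}(add0n k.+1) big_addn big_mkord subSS.
    by apply: eq_bigr => j _; rewrite addnS addnC; congr (prepend _ (h _)); lia.
  rewrite (exchange_big_dep xpredT) //=; apply: eq_bigr => s _.
  by rewrite sumr_const card_ord_lt.
rewrite hS -sumrMnl -!big_split /=; apply: eq_bigr => j _.
rewrite -mulrS -mulrnDr; congr (_ *+ _); move: (ltn_ord j); lia.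
Qed.

(** * Extension of homomorphisms from H0 to H1 *)

(* [R] as a vector space over [rat], so that [fglift] extends functions of words
   to [R] linearly. *)
Definition rat_module (R : numFieldType) : Type := R.
HB.instance Definition _ (R : numFieldType) := GRing.Zmodule.on (rat_module R).

Section rat_module.
Variable R : numFieldType.

Definition rat_scale (q : rat) (x : rat_module R) : rat_module R := ratr q * (x : R).
Lemma rat_scaleA a b v : rat_scale a (rat_scale b v) = rat_scale (a * b) v.
Proof. by rewrite /rat_scale rmorphM mulrA. Qed.
Lemma rat_scale1 : left_id 1 rat_scale.
Proof. by move=> v; rewrite /rat_scale rmorph1 mul1r. Qed.
Lemma rat_scaleDr : right_distributive rat_scale +%R.
Proof. by move=> a u v; rewrite /rat_scale mulrDr. Qed.
Lemma rat_scaleDl v : {morph rat_scale^~ v: a b / a + b}.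
Proof. by move=> a b; rewrite /rat_scale rmorphD mulrDl. Qed.

HB.instance Definition _ := GRing.Zmodule_isLmodule.Build rat (rat_module R)
  rat_scaleA rat_scale1 rat_scaleDr rat_scaleDl.

Definition ext (f : word -> R) (a : H1) : R := fglift (f : word -> rat_module R) a.

Lemma ext_word f w : ext f (of_word w) = f w.
Proof. exact: (@fglift_of_word (rat_module R)). Qed.

Lemma extD f a b : ext f (a + b) = ext f a + ext f b.
Proof. exact: (@fgliftD (rat_module R)). Qed.

Lemma extB f a b : ext f (a - b) = ext f a - ext f b.
Proof. exact: (@fgliftB (rat_module R)). Qed.

Lemma ext0 f : ext f 0 = 0.
Proof. exact: (@fglift0 (rat_module R)). Qed.

Lemma extZ f k a : ext f (k *: a) = ratr k * ext f a.
Proof. exact: (@fgliftZ (rat_module R)). Qed.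

Lemma extE f a : ext f a = \sum_(w <- dom a) ratr (coeff w a) * f w.
Proof. exact: (@fgliftE (rat_module R)). Qed.

Lemma extMn f n a : ext f (a *+ n) = ext f a *+ n.
Proof. by elim: n => [|n IHn]; rewrite ?ext0 // !mulrS extD IHn. Qed.

Lemma eq_ext f g a : {in dom a, f =1 g} -> ext f a = ext g a.
Proof. by move=> fg; rewrite !extE; apply: eq_big_seq => w /fg ->. Qed.

Lemma ext_mull f a b :
  ext f (a * b) = \sum_(w <- dom a) ratr (coeff w a) * ext f (of_word w * b).
Proof.
have -> : @GRing.mul H1 = quasi_mul by [].
rewrite {1}/quasi_mul fgliftE (big_morph _ (extD f) (ext0 f)).
by apply: eq_bigr => w _; rewrite extZ /quasi_mul fglift_of_word.
Qed.

End rat_module.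

(** * Filtration of H1 by the number of leading letters z_1 *)

Definition lead (w : word) : nat := find (fun i : letter => val i != 1%N) w.

Arguments lead : simpl never.
Arguments word_mul : simpl never.

Lemma admissibleE w : admissible w = (lead w == 0%N).
Proof. by case: w => [|[[|[|i]] ?] w]. Qed.

Definition lead_le (k : nat) (a : H1) : bool := all (fun w => (lead w <= k)%N) (dom a).

Lemma lead_leP k (a : H1) :
  reflect (forall w, coeff w a != 0 -> (lead w <= k)%N) (lead_le k a).
Proof.
by apply: (iffP allP) => adm w; have := adm w; rewrite mem_dom.
Qed.

Lemma lead_le0 k : lead_le k 0.
Proof. by rewrite /lead_le dom0. Qed.

Lemma lead_leD k a b : lead_le k a -> lead_le k b -> lead_le k (a + b).
Proof.
move=> /lead_leP la /lead_leP lb; apply/lead_leP => w; rewrite coeffD.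
have [a0|/la //] := eqVneq (coeff w a) 0.
by rewrite a0 add0r => /lb.
Qed.

Lemma lead_leZ k c a : lead_le k a -> lead_le k (c *: a).
Proof.
move=> /lead_leP la; apply/lead_leP => w; rewrite coeffZ.
by have [->|/la //] := eqVneq (coeff w a) 0; rewrite mulr0 eqxx.
Qed.

Lemma lead_le_word k w : lead_le k (of_word w) = (lead w <= k)%N.
Proof. by rewrite /lead_le domU1 /= andbT. Qed.

Lemma lead_le_prepend k i a :
  (forall w, w \in dom a -> (lead (i :: w) <= k)%N) -> lead_le k (prepend i a).
Proof.
move=> la; rewrite /prepend fgliftE big_seq.
elim/big_ind: _ => [|x y|w /la]; [exact: lead_le0|exact: lead_leD|].
by move=> lw; rewrite lead_leZ ?lead_le_word.
Qed.

Local Notation z1 := (letterS 0).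

Lemma prependB i a b : prepend i (a - b) = prepend i a - prepend i b.
Proof. exact: fgliftB. Qed.

(** Inserting z_1 at any of the [(lead w).+1] places of the leading block gives z_1 w; every other
    place or merger leaves at most [lead w] leading z_1. *)
Lemma z1_mul_word w : lead_le (lead w)
  (of_word [:: z1] * of_word w - of_word (z1 :: w) *+ (lead w).+1).
Proof.
rewrite mulH1_word; elim: w => [|j v IHv].
  by rewrite /= mulr1n subrr lead_le0.
rewrite word_mul_cons !word_mul_nil_l !prepend_word /=.
have [j1|j1] := eqVneq (val j) 1%N.
  have -> : j = z1 by apply: val_inj.
  have -> : lead (z1 :: v) = (lead v).+1 by [].
  (* The term with the new z_1 in front uses up one of the [(lead v).+2] copies; the others fall to
     the induction hypothesis below one more z_1. *)
  rewrite (_ : _ - _ = prepend z1 (word_mul [:: z1] v - of_word (z1 :: v) *+ (lead v).+1)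
     + of_word (letter_add z1 z1 :: v)); last first.
    rewrite mulrS prependB prependMn prepend_word.
    by ring.
  apply: lead_leD; last by rewrite lead_le_word.
  by apply: lead_le_prepend => w /(allP IHv).
have -> : lead (j :: v) = 0%N by rewrite /lead /= j1.
rewrite mulr1n (_ : _ - _ = prepend j (word_mul [:: z1] v) +
  of_word (letter_add z1 j :: v)); last by ring.
apply: lead_leD; last by rewrite lead_le_word /lead /= eqSS -lt0n (valP j).
by apply: lead_le_prepend => w _; rewrite /lead /= j1.
Qed.

Section extension.
Variables (R : numFieldType) (f : word -> R) (c : R).

(* The relation of [z1_mul_word] solved for the word with the most leading
   [z1], correct on words with at most [k] of them. *)
Fixpoint reg_upto (k : nat) (w : word) : R :=
  if k is k'.+1 then
    if (lead w <= k')%N then reg_upto k' w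
    else (c * reg_upto k' (behead w) - ext (reg_upto k')
       (of_word [:: z1] * of_word (behead w) - of_word (z1 :: behead w) *+ k)) / k%:R
  else f w.

Definition reg (w : word) : R := reg_upto (lead w) w.

Lemma reg_upto_reg k w : (lead w <= k)%N -> reg_upto k w = reg w.
Proof.
elim: k => [|k IHk]; first by rewrite leqn0 /reg => /eqP->.
rewrite leq_eqVlt ltnS => /orP[/eqP wk|lk]; last by rewrite /= lk IHk.
by rewrite /reg wk.
Qed.

Lemma reg_admissible w : admissible w -> reg w = f w.
Proof. by rewrite admissibleE /reg => /eqP->. Qed.

(** For a word [w], the value of [reg] at z_1 w was defined by solving exactly this equation. *)
Lemma ext_reg_z1 a : ext reg (of_word [:: z1] * a) = c * ext reg a.
Proof.
elim/H1_ind: a => [|k w a IHa]; first by rewrite mulr0 ext0 mulr0.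
rewrite mulrDr !extD IHa mulrDr; congr (_ + _).
rewrite -scalerAr !extZ mulrCA; congr (_ * _); rewrite ext_word.
have := z1_mul_word w; set r := (_ - _) => lr.
have -> : of_word [:: z1] * of_word w = of_word (z1 :: w) *+ (lead w).+1 + r.
  by rewrite /r addrC subrK.
have lz : lead (z1 :: w) = (lead w).+1 by [].
rewrite extD extMn ext_word {1}/reg lz /= lz ltnn -/r /= -[X in X + _]mulr_natr.
rewrite mulfVK ?pnatr_eq0 // (reg_upto_reg (leqnn _)).
rewrite (@eq_ext _ _ reg) ?subrK // => v vr.
by apply: reg_upto_reg; apply: (allP lr).
Qed.

(** Induction on the number of leading z_1: (k + 1) z_1 u is z_1 * u minus words with at most k
    leading z_1, and multiplication by z_1 acts as [c]. *)
Lemma ext_reg_mull b :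
  (forall u, admissible u -> ext reg (of_word u * b) = reg u * ext reg b) ->
  forall a, ext reg (a * b) = ext reg a * ext reg b.
Proof.
move=> adm.
suff W k u : (lead u <= k)%N -> ext reg (of_word u * b) = reg u * ext reg b.
  elim/H1_ind => [|k w a IHa]; first by rewrite mul0r ext0 mul0r.
  by rewrite mulrDl !extD IHa mulrDl -scalerAl !extZ (W _ _ (leqnn _)) ext_word mulrA.
elim: k u => [|k IHk] u lu; first by rewrite adm // admissibleE -leqn0.
have [lk|] := leqP (lead u) k; first exact: IHk.
case: u lu => // i u lu lk.
have i1 : i = z1.
  by apply: val_inj; move: lk; rewrite /lead /=; case: eqP.
rewrite {i}i1 in lu lk *.
have uk : lead u = k.
  by apply/eqP; move: lu lk; rewrite (_ : lead (z1 :: u) = (lead u).+1) // !ltnS eqn_leq => -> ->.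
have := z1_mul_word u; set r := (_ - _) => lr.
have rE : of_word (z1 :: u) *+ (lead u).+1 = of_word [:: z1] * of_word u - r.
  by rewrite /r opprB addrC subrK.
clearbody r.
have extr : ext reg (r * b) = ext reg r * ext reg b.
  rewrite ext_mull (extE reg) mulr_suml; apply: eq_big_seq => v vr.
  rewrite IHk ?mulrA //; last by rewrite -uk; apply: (allP lr).
apply: (@mulIf _ k.+1%:R); first by rewrite pnatr_eq0.
transitivity (ext reg (of_word (z1 :: u) * b *+ k.+1)); first by rewrite extMn mulr_natr.
rewrite -mulrnAl -{1}uk rE mulrBl extB -mulrA ext_reg_z1 IHk ?uk // extr mulrA -mulrBl.
by rewrite mulrAC mulr_natr -(ext_word reg (z1 :: u)) -extMn -uk rE extB ext_reg_z1 ext_word.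
Qed.

Hypothesis f_nil : f [::] = 1.
Hypothesis f_mul : forall u v, admissible u -> admissible v ->
  ext f (word_mul u v) = f u * f v.

(** [ext_reg_mull] reduces one factor and then, by commutativity, the other to admissible words,
    whose product lies in H0, where [reg] is [f]. *)
Lemma ext_regM a b : ext reg (a * b) = ext reg a * ext reg b.
Proof.
apply: ext_reg_mull => {a} u adm_u; rewrite mulrC [RHS]mulrC -[reg u]ext_word.
apply: ext_reg_mull => {b} v adm_v; rewrite mulH1_word ext_word !reg_admissible //.
rewrite -f_mul //; apply: eq_ext => w ww; apply: reg_admissible.
by have /allP := H0_word_mul adm_v adm_u; apply.
Qed.

Lemma ext_reg_zmod : zmod_morphism (ext reg).
Proof. exact: extB. Qed.

Lemma ext_reg_monoid : monoid_morphism (ext reg).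
Proof.
split; last exact: ext_regM.
by rewrite (ext_word reg [::]) reg_admissible.
Qed.

Lemma ext_reg_scalable : scalable_for ((@ratr R) \; *%R) (ext reg).
Proof. by move=> k a; rewrite extZ. Qed.

(** Used with the multiple t-values and c = ln 2 for theta itself, and with truncated sums and
    [trunc_z1 N] for its approximations. *)
Lemma extension : exists2 theta : {lrmorphism H1 -> R | (@ratr R) \; *%R},
  theta (of_word [:: z1]) = c &
  forall w, admissible w -> theta (of_word w) = f w.
Proof.
pose m1 := GRing.isZmodMorphism.Build _ _ (ext reg) ext_reg_zmod.
pose m2 := GRing.isMonoidMorphism.Build _ _ (ext reg) ext_reg_monoid.
pose m3 := GRing.isScalable.Build _ _ _ _ (ext reg) ext_reg_scalable.
pose t : {lrmorphism H1 -> R | (@ratr R) \; *%R} := HB.pack (ext reg) m1 m2 m3.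
exists t.
  by rewrite -[of_word _]mulr1 /= ext_reg_z1 (ext_word reg [::]) reg_admissible // f_nil mulr1.
by move=> w aw; rewrite /= ext_word reg_admissible.
Qed.
End extension.

Local Open Scope classical_set_scope.

(** * Truncated multiple t-values *)

Lemma esumZl (R : realType) (T : choiceType) (S : set T) (r : R) (a : T -> \bar R) :
  (0 < r)%R -> (forall x, (0 <= a x)%E) ->
  (\esum_(x in S) (r%:E * a x) = r%:E * \esum_(x in S) a x)%E.
Proof.
move=> r0 a0; rewrite /esum -ereal_sup_pZl //; congr ereal_sup.
rewrite image_comp; apply: eq_imagel => A [finA AS] /=.
by rewrite ge0_mule_fsumr.
Qed.

Lemma cvg_sum_seq (R : realType) (I : eqType) (r : seq I) (f : I -> nat -> R) (l : I -> R) :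
  {in r, forall i, f i N @[N --> \oo] --> l i} ->
  \sum_(i <- r) f i N @[N --> \oo] --> \sum_(i <- r) l i.
Proof.
elim: r => [_|i r IHr fl].
  by rewrite big_nil; under eq_fun do rewrite big_nil; apply: cvg_cst.
rewrite big_cons; under eq_fun do rewrite big_cons.
apply: cvgD; first by apply: fl; rewrite mem_head.
by apply: IHr => j jr; apply: fl; rewrite inE jr orbT.
Qed.

Section truncation.
Variable R : realType.
Implicit Types (w u v : word) (N : nat).

(** The parity factor kills even indices, so that truncations can run over all integers. *)
Definition odd_pow (i : letter) (n : nat) : R := (odd n)%:R * n%:R ^- val i.

Lemma odd_pow_ge0 i n : 0 <= odd_pow i n.
Proof. by rewrite mulr_ge0 // invr_ge0 exprn_ge0. Qed.

Lemma odd_powD i j n : odd_pow (letter_add i j) n = odd_pow i n * odd_pow j n.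
Proof.
rewrite /odd_pow exprD invfM; case: odd; first by rewrite !mul1r.
by rewrite !mul0r.
Qed.

(* The terms of the multiple t-value with largest index n_1 <= N; the recursion
   isolates those with n_1 = N. *)
Fixpoint trunc (N : nat) (w : word) : R :=
  match N, w with
  | _, [::] => 1
  | 0%N, _ => 0
  | N'.+1, i :: w' => trunc N' w + odd_pow i N * trunc N' w'
  end.

Lemma trunc_nil N : trunc N [::] = 1.
Proof. by case: N. Qed.

Lemma truncS N i w :
  trunc N.+1 (i :: w) = trunc N (i :: w) + odd_pow i N.+1 * trunc N w.
Proof. by []. Qed.

Lemma trunc_ge0 N w : 0 <= trunc N w.
Proof.
elim: N w => [|N IHN] [|i w] //; rewrite ?trunc_nil // truncS.
by rewrite addr_ge0 ?mulr_ge0 ?odd_pow_ge0.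
Qed.

Lemma ext_trunc_prepend N i a :
  ext (trunc N.+1) (prepend i a) = ext (trunc N) (prepend i a) + odd_pow i N.+1 * ext (trunc N) a.
Proof.
elim/H1_ind: a => [|k w a IHa]; first by rewrite prepend0 !ext0 mulr0 addr0.
rewrite prependD prependZ prepend_word !extD IHa !extZ !ext_word truncS; ring.
Qed.

(** In passing from [N] to [N.+1], the new index belongs to the first word, to the second or to
    both; these are the three terms of the quasi-shuffle recursion. *)
Lemma trunc_mul N u v : ext (trunc N) (word_mul u v) = trunc N u * trunc N v.
Proof.
elim: N u v => [|N IHN] [|i u] [|j v];
  rewrite ?word_mul_nil_l ?word_mul_nil_r ?ext_word ?trunc_nil ?mul1r ?mulr1 //.
  rewrite word_mul_cons !extD mul0r.
  have E k a : ext (trunc 0) (prepend k a) = 0.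
    elim/H1_ind: a => [|c w a IHa]; first by rewrite prepend0 ext0.
    by rewrite prependD prependZ prepend_word extD IHa extZ ext_word mulr0 addr0.
  by rewrite !E !addr0.
rewrite word_mul_cons !extD !ext_trunc_prepend odd_powD !IHN !truncS.
transitivity (ext (trunc N) (word_mul (i :: u) (j :: v))
  + odd_pow i N.+1 * (trunc N u * trunc N (j :: v))
  + odd_pow j N.+1 * (trunc N (i :: u) * trunc N v)
  + odd_pow i N.+1 * odd_pow j N.+1 * (trunc N u * trunc N v)).
  by rewrite word_mul_cons !extD; ring.
by rewrite IHN; ring.
Qed.

Lemma trunc_homo w : {homo trunc ^~ w : M N / (M <= N)%N >-> M <= N}.
Proof.
apply: homo_leq => // [|N]; first exact: le_trans.
case: w => [|i w]; first by rewrite !trunc_nil.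
by rewrite truncS lerDl mulr_ge0 ?odd_pow_ge0 ?trunc_ge0.
Qed.

Definition idx (k : nat) : set (k.-tuple nat) :=
  [set n : k.-tuple nat | sorted gtn n /\ all odd n].

Arguments idx : clear implicits.

Definition idx_le (N k : nat) : set (k.-tuple nat) :=
  idx k `&` [set n | all (fun m => (m <= N)%N) n].

Arguments idx_le : clear implicits.

Definition idx_term (w : word) (n : (size w).-tuple nat) : R :=
  \prod_(j < size w) (tnth n j)%:R ^- val (tnth (in_tuple w) j).

Lemma idx_term_ge0 w n : 0 <= @idx_term w n.
Proof. by apply: prodr_ge0 => j _; rewrite invr_ge0 exprn_ge0. Qed.

Lemma idx_term_cons i w m (n : (size w).-tuple nat) :
  @idx_term (i :: w) (cons_tuple m n) = m%:R ^- val i * @idx_term w n.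
Proof.
rewrite /idx_term big_ord_recl /=; congr (_ ^- _ * _).
by apply: eq_bigr => j _; rewrite !(tnth_nth 0%N) !(tnth_nth i).
Qed.

Lemma esum_trunc N w : (\esum_(n in idx_le N (size w)) (@idx_term w n)%:E)%E = (trunc N w)%:E.
Proof.
elim: N w => [|N IHN] [|i w].
- rewrite /= (_ : idx_le _ _ = [set [tuple]]); last first.
    by apply/seteqP; split=> [t _|t ->]; [rewrite [t]tuple0|].
  by rewrite esum_set1 /idx_term big_ord0.
- rewrite /= (_ : idx_le _ _ = set0) ?esum_set0 //.
  by apply/seteqP; split=> // t [[_ ]]; case: (tupleP t) => -[|m] t' /=.
- rewrite /= (_ : idx_le _ _ = [set [tuple]]); last first.
    by apply/seteqP; split=> [t _|t ->]; [rewrite [t]tuple0|].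
  by rewrite esum_set1 /idx_term big_ord0.
(* Split according to whether the largest index is at most N or equal to N + 1. *)
rewrite (esumID [set n : (size (i :: w)).-tuple nat | all (fun m => (m <= N)%N) n]) => [|n _]; last first.
  by rewrite lee_fin idx_term_ge0.
rewrite truncS EFinD; congr (_ + _)%E.
  rewrite -IHN; congr esum; apply/seteqP; split => [n [[? _] ?]|n [? /= nN]]; split => //.
  by split=> //; apply: sub_all nN => m; exact: leqW.
case oddN: (odd N.+1); last first.
  rewrite /odd_pow oddN !mul0r (_ : _ `&` _ = set0) ?esum_set0 //.
  apply/seteqP; split=> // t [[[_ /allP ot] /allP tN]]; apply.
  apply/allP => m mt; have := tN _ mt; rewrite leq_eqVlt => /orP[/eqP mN|//].
  by have := ot _ mt; rewrite mN oddN.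
have bij : set_bij (idx_le N (size w))
   (idx_le N.+1 (size w).+1 `&` ~` [set n | all (fun m => (m <= N)%N) n])
   (fun n : (size w).-tuple nat => cons_tuple N.+1 n).
  split=> [n [[sn on] nN]|m n _ _ [] mn|t [[[st ot] tN] ntN]].
  - split; last by rewrite /= ltnn.
    split; last by rewrite /= leqnn /=; apply: sub_all nN => m; exact: leqW.
    by split; rewrite /= ?path_min_sorted ?sn ?nN //; apply/andP.
  - exact: val_inj.
  move: st ot tN ntN; case: (tupleP t) => m n /= pn /andP[om on] /andP[mN nN] ntN.
  have nm : all (gtn m) n by apply: order_path_min pn => x y z /= xy yz; apply: ltn_trans yz xy.
  have mE : m = N.+1.
    apply/eqP; rewrite eqn_leq mN ltnNge; apply/negP => mN'; apply: ntN.
    by rewrite mN' /=; apply: sub_all nm => x /ltnW /leq_trans; apply.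
  exists n; last by apply: val_inj; rewrite /= mE.
  split; first by split=> //; apply: path_sorted pn.
  by rewrite mE in nm.
rewrite (reindex_esum _ _ _ _ bij) /odd_pow oddN mul1r.
rewrite (eq_esum (b := fun n => (N.+1%:R ^- val i)%:E * (@idx_term w n)%:E)%E) => [|n _]; last first.
  by rewrite idx_term_cons EFinM.
rewrite esumZl ?invr_gt0 ?exprn_gt0 //; first by rewrite IHN EFinM.
by move=> n; rewrite lee_fin idx_term_ge0.
Qed.

(** The terms are nonnegative, so both sides are suprema, and every finite set of index tuples lies
    in some truncation. *)
Lemma esum_idx_cvg w :
  (trunc N w)%:E @[N --> \oo] --> (\esum_(n in idx (size w)) (@idx_term w n)%:E)%E.
Proof.
have nd : nondecreasing_seq (fun N => (trunc N w)%:E).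
  by move=> M N MN; rewrite lee_fin trunc_homo.
have := ereal_nondecreasing_cvgn nd; congr (_ --> _).
apply/eqP; rewrite eq_le; apply/andP; split.
  apply: ge_ereal_sup => _ [N _ <-]; rewrite -esum_trunc; apply: ereal_sup_le.
  by move=> _ [A [finA AS] <-]; exists A => //; split=> // n /AS [].
apply: ge_ereal_sup => _ [A [finA AS] <-].
have /finite_seqP [s sA] := finA.
(* A crude bound: each entry of a tuple is at most the sum of its entries. *)
pose N := (\max_(n <- s) \sum_(m <- n) m)%N.
apply: (@le_trans _ _ (trunc N w)%:E); last by apply: ereal_sup_ubound; exists N.
rewrite -esum_trunc; apply: esum_ge; exists A => //; split=> // n An; split; first exact: AS.
apply/allP => m mn; apply: (@leq_trans (\sum_(m <- n) m)%N).
  by rewrite (big_rem m) //= leq_addr.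
by apply: (@leq_bigmax_seq _ _ xpredT (fun n : (size w).-tuple nat => \sum_(m <- n) m)%N);
  move: An; rewrite sA.
Qed.

Lemma odd_pow_le k i n : (k <= val i)%N -> odd_pow i n.+1 <= n.+1%:R ^- k.
Proof.
move=> ki; rewrite /odd_pow; case: odd; last by rewrite mul0r invr_ge0 exprn_ge0.
by rewrite mul1r lef_pV2 ?posrE ?exprn_gt0 // ler_weXn2l ?ler1n.
Qed.

(** These relations turn the two estimates below into polynomial inequalities in [s] and [t]. *)
Lemma sqrt_step N : let s := Num.sqrt N.+1%:R : R in let t := Num.sqrt N.+2%:R : R in
  [/\ 0 < s, s ^+ 2 = N.+1%:R, (t - s) * (t + s) = 1, s < t & t <= 2 * s].
Proof.
move=> s t.
have s0 : 0 < s by rewrite sqrtr_gt0.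
have sE : s ^+ 2 = N.+1%:R by rewrite sqr_sqrtr.
have tE : t ^+ 2 = N.+2%:R by rewrite sqr_sqrtr.
split=> //.
- by rewrite -subr_sqr tE sE -natrB // subSnn.
- by rewrite ltr_sqrt ?ltr_nat.
have t0 : 0 <= t := sqrtr_ge0 _.
have : t ^+ 2 <= 4 * s ^+ 2 by rewrite tE sE -natrM ler_nat; lia.
nra.
Qed.

(** The bound survives summation over the largest index by telescoping: the new term is at most C /
    s, and 1 / s <= 4 (t - s). *)
Lemma trunc_le_sqrt w : exists2 C : R, 0 < C & forall N, trunc N w <= C * Num.sqrt N.+1%:R.
Proof.
elim: w => [|i w [C C0 wC]].
  by exists 1 => // N; rewrite trunc_nil mul1r -{1}sqrtr1 ler_sqrt ?ler1n.
exists (4 * C); first by rewrite mulr_gt0.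
elim=> [|N IHN]; first by rewrite mulr_ge0 ?sqrtr_ge0 // ltW // mulr_gt0.
rewrite truncS; have [] := sqrt_step N; move: IHN (wC N).
set s := Num.sqrt N.+1%:R; set t := Num.sqrt N.+2%:R => IHN wN s0 sE ts1 st t2.
clearbody s t.
have le1 : odd_pow i N.+1 * trunc N w <= C / s.
  apply: (@le_trans _ _ (N.+1%:R^-1 * (C * s))).
    by rewrite ler_pM ?odd_pow_ge0 ?trunc_ge0 // (odd_pow_le (k := 1)) // (valP i).
  have -> : N.+1%:R^-1 * (C * s) = C / s by rewrite -sE; field; rewrite gt_eqF.
  exact: lexx.
suff : s^-1 <= 4 * (t - s) by move=> ?; nra.
rewrite -[s^-1]mul1r ler_pdivrMr //; nra.
Qed.

(** A first exponent of at least 2 makes the new term at most C / s ^ 3, which the telescoping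
    difference 6 C / s - 6 C / t dominates. *)
Lemma trunc_bounded w : admissible w -> exists C : R, forall N, trunc N w <= C.
Proof.
case: w => [_|i w i1]; first by exists 1 => N; rewrite trunc_nil.
have [C C0 wC] := trunc_le_sqrt w.
(* Subtracting the tail term makes the bound inductive. *)
exists (6 * C) => N; apply: (@le_trans _ _ (6 * C - 6 * C / Num.sqrt N.+1%:R)); last first.
  by rewrite gerBl divr_ge0 ?sqrtr_ge0 // ltW // mulr_gt0.
elim: N => [|N IHN]; first by rewrite sqrtr1 divr1 subrr.
rewrite truncS; have [] := sqrt_step N; move: IHN (wC N).
set s := Num.sqrt N.+1%:R; set t := Num.sqrt N.+2%:R => IHN wN s0 sE ts1 st t2.
clearbody s t.
have le1 : odd_pow i N.+1 * trunc N w <= C / s ^+ 3.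
  apply: (@le_trans _ _ (N.+1%:R ^- 2 * (C * s))).
    by rewrite ler_pM ?odd_pow_ge0 ?trunc_ge0 // odd_pow_le.
  have -> : N.+1%:R ^- 2 * (C * s) = C / s ^+ 3 by rewrite -sE; field; rewrite gt_eqF.
  exact: lexx.
have t0 : 0 < t by apply: lt_trans st.
suff : C / s ^+ 3 <= 6 * C / s - 6 * C / t by lra.
have -> : 6 * C / s - 6 * C / t = 6 * C * (t - s) / (s * t).
  by field; rewrite !gt_eqF.
have -> : t - s = (t + s)^-1.
  by apply: (@mulIf _ (t + s)); rewrite ?ts1 ?mulVf // gt_eqF // addr_gt0.
rewrite -!mulrA mulrCA ler_pM2l // -invfM ler_pdivlMr ?mulr_gt0 ?addr_gt0 //.
rewrite mulrC ler_pdivrMr ?exprn_gt0 //.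
suff : t * (t + s) <= 6 * s ^+ 2 by rewrite exprS => ?; nra.
nra.
Qed.

(** Boundedness makes the unordered sum finite, so that [fine] in [mtv] loses nothing. *)
Lemma mtv_fin w : admissible w ->
  (\esum_(n in idx (size w)) (@idx_term w n)%:E)%E = (mtv R w)%:E.
Proof.
move=> /trunc_bounded [C wC]; rewrite [RHS]fineK // fin_numE; apply/andP; split.
  by rewrite -leeNy_eq -ltNge (lt_le_trans (ltNyr 0)) // esum_ge0 // => n _; rewrite lee_fin idx_term_ge0.
rewrite -leye_eq -ltNge (@le_lt_trans _ _ C%:E) ?ltry //.
rewrite -(cvg_lim _ (@esum_idx_cvg w)) //.
apply: lime_le; first by apply/cvg_ex; eexists; exact: esum_idx_cvg.
by near=> N; rewrite lee_fin.
Unshelve. all: by end_near. Qed.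

Lemma trunc_cvg w : admissible w -> trunc N w @[N --> \oo] --> mtv R w.
Proof.
by move=> adm; have := @esum_idx_cvg w; rewrite mtv_fin // => /fine_cvg.
Qed.

Lemma ext_trunc_cvg a : a \in H0 -> ext (trunc N) a @[N --> \oo] --> ext (mtv R) a.
Proof.
move=> /allP H0a; rewrite extE; under eq_fun do rewrite extE.
apply: cvg_sum_seq => w wa; apply: cvgM; first exact: cvg_cst.
exact/trunc_cvg/H0a.
Qed.

Lemma mtv_nil : mtv R [::] = 1.
Proof.
have := @trunc_cvg [::] isT; rewrite (_ : trunc ^~ [::] = cst 1).
  by move=> /cvg_lim <- //; rewrite lim_cst.
by apply/funext => N; rewrite trunc_nil.
Qed.

Lemma mtv_mul u v : admissible u -> admissible v ->
  ext (mtv R) (word_mul u v) = mtv R u * mtv R v.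
Proof.
move=> au av; have := ext_trunc_cvg (H0_word_mul au av).
rewrite (_ : (fun N => _) = (fun N => trunc N u * trunc N v)).
  move=> /cvg_lim <- //; apply/cvg_lim => //.
  by apply: cvgM; apply: trunc_cvg.
by apply/funext => N; rewrite trunc_mul.
Qed.

Lemma theta0E a : theta0 R a = ext (mtv R) a.
Proof. by rewrite extE. Qed.

Lemma trunc_letter N k : trunc N.*2 [:: letterS k] = \sum_(0 <= j < N) j.*2.+1%:R ^- k.+1.
Proof.
elim: N => [|N IHN]; first by rewrite big_nil.
rewrite doubleS !truncS IHN !trunc_nil !mulr1 big_nat_recr //= -addrA; congr (_ + _).
by rewrite /odd_pow /= odd_double /= mul1r mul0r addr0.
Qed.

Lemma odd_zeta_cvg k : (0 < k)%N ->
  \sum_(0 <= j < N) j.*2.+1%:R ^- k.+1 @[N --> \oo] --> mtv R [:: letterS k].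
Proof.
move=> k0; rewrite (_ : (fun N => _) = (trunc ^~ [:: letterS k]) \o muln 2).
  exact: cvg_comp (@cvg_mulnl 2 isT) (@trunc_cvg [:: letterS k] k0).
by apply/funext => N /=; rewrite mul2n trunc_letter.
Qed.

End truncation.

(** * The Gamma function *)

Section Gamma.
Variable R : realType.
Notation mu := (@lebesgue_measure R).

Definition gamma_fun (s t : R) : R := t `^ (s - 1) * expR (- t).

Lemma gamma_fun_ge0 s t : 0 <= gamma_fun s t.
Proof. by rewrite mulr_ge0 ?powR_ge0 ?expR_ge0. Qed.

Lemma measurable_gamma_fun s D : measurable_fun D (gamma_fun s).
Proof.
apply: measurable_funTS; apply: measurable_funM; first exact: measurable_powR.
by apply: measurableT_comp => //; exact: measurable_funN.
Qed.

(** Kept in the extended reals: finiteness is derived later from the functional equation and an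
    inequality. *)
Definition eGamma (s : R) : \bar R := (\int[mu]_(t in `]0%R, +oo[) (gamma_fun s t)%:E)%E.

Lemma GammaE s : Gamma s = fine (eGamma s).
Proof. by []. Qed.

Lemma eGamma_ge0 s : (0 <= eGamma s)%E.
Proof. by apply: integral_ge0 => t _; rewrite lee_fin gamma_fun_ge0. Qed.

Lemma integral_exhaust (f : R -> R) (u v : R^nat) :
  (forall t, 0 < t -> 0 <= f t) -> measurable_fun setT f ->
  (forall n, 0 < u n) -> {homo u : m n / (m <= n)%N >-> n <= m} ->
  {homo v : m n / (m <= n)%N >-> m <= n} ->
  (forall t, 0 < t -> exists n, u n <= t <= v n) ->
  (\int[mu]_(t in `[u n, v n]) (f t)%:E)%E @[n --> \oo]
    --> (\int[mu]_(t in `]0%R, +oo[) (f t)%:E)%E.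
Proof.
move=> f0 mf u0 ndu ndv uv.
have -> : `]0%R, +oo[%classic = \bigcup_n `[u n, v n]%classic.
  apply/seteqP; split=> [t|t [n _]] /=; rewrite !in_itv /= ?andbT.
    by move=> /uv [n tn]; exists n => //=; rewrite in_itv.
  by move=> /andP[ut _]; apply: lt_le_trans ut.
apply: ge0_nondecreasing_set_cvg_integral => //.
- move=> m n mn; apply/subsetPset => t /=; rewrite !in_itv /= => /andP[ut tv].
  by rewrite (le_trans (ndu _ _ mn)) // (le_trans tv) // ndv.
- move=> n; apply/measurable_EFinP; exact: measurable_funTS.
- move=> n t /=; rewrite in_itv /= => /andP[ut _]; rewrite lee_fin f0 //.
  exact: lt_le_trans ut.
Qed.

(** The intervals for k = 2 are the images under squaring of those for k = 1; [n.+2] keeps them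
    nondegenerate. *)
Lemma integral_exhaustX (f : R -> R) k : (0 < k)%N ->
  (forall t, 0 < t -> 0 <= f t) -> measurable_fun setT f ->
  (\int[mu]_(t in `[(n.+2%:R^-1 ^+ k)%R, (n.+2%:R ^+ k)%R]) (f t)%:E)%E @[n --> \oo]
    --> (\int[mu]_(t in `]0%R, +oo[) (f t)%:E)%E.
Proof.
move=> k0 f0 mf; apply: (integral_exhaust (u := fun n => n.+2%:R^-1 ^+ k) (v := fun n => n.+2%:R ^+ k)) => //.
- move=> m n mn; rewrite lerXn2r ?nnegrE ?invr_ge0 //.
  by rewrite lef_pV2 ?posrE // ler_nat !ltnS.
- by move=> m n mn; rewrite lerXn2r ?nnegrE // ler_nat !ltnS.
(* An integer above t + 1 / t bounds both t and 1 / t. *)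
move=> t t0; pose n := Num.bound (t + t^-1); exists n.
have tt0 : 0 <= t + t^-1 by rewrite addr_ge0 ?invr_ge0 ?ltW.
have := archi_boundP tt0; rewrite -/n => ltn.
have lt2 : t + t^-1 <= n.+2%:R by rewrite (le_trans (ltW ltn)) // ler_nat leqW.
have n1 : 1 <= n.+2%:R :> R by rewrite ler1n.
have it0 : 0 < t^-1 by rewrite invr_gt0.
have n2 : n.+2%:R <= n.+2%:R ^+ k :> R by case: (k) k0 => // j _; rewrite ler_eXnr.
have tn : t <= n.+2%:R by rewrite (le_trans _ lt2) // lerDl ltW.
have tVn : t^-1 <= n.+2%:R by rewrite (le_trans _ lt2) // lerDr ltW.
rewrite (le_trans tn n2) andbT exprVn -[leRHS]invrK lef_pV2 ?posrE ?exprn_gt0 //.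
exact: le_trans n2.
Qed.

Lemma is_derive_expRN (x : R) : is_derive x 1 (fun t : R => expR (- t)) (- expR (- x)).
Proof.
rewrite -[X in is_derive _ _ _ X]mulrN1.
exact: (@is_derive1_comp _ expR -%R x _ _ (is_derive_expR _) (is_deriveN (is_derive_id _ _))).
Qed.

Lemma is_derive_LR (F f : R -> R) (a b : R) :
  (forall x, a <= x <= b -> is_derive x 1 F (f x)) -> a <= b ->
  derivable_oo_LRcontinuous F a b.
Proof.
move=> dF ab; have cF x : a <= x <= b -> {for x, continuous F}.
  by move=> /dF [+ _] => /derivable1_diffP/differentiable_continuous.
split.
- by move=> x; rewrite in_itv /= => /andP[ax xb]; have [] := dF x _; rewrite ?ltW.
- by apply: cvg_at_right_filter; apply: cF; rewrite lexx ab.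
- by apply: cvg_at_left_filter; apply: cF; rewrite lexx ab.
Qed.

Lemma within_derive_continuous (F f : R -> R) (a b : R) :
  (forall x, a <= x <= b -> is_derive x 1 F (f x)) -> {within `[a, b], continuous F}.
Proof.
move=> dF; apply: derivable_within_continuous => x; rewrite in_itv /= => /dF [].
by [].
Qed.

Lemma powR_inv_cvg0 a : 0 < a -> n.+2%:R^-1 `^ a @[n --> \oo] --> (0 : R).
Proof.
move=> a0; have /cvg_at_rightP := @powR_cvg0 R a a0.
move=> /(_ (fun n => n.+2%:R^-1)); apply; split=> [n|]; first by rewrite invr_gt0.
by have := @cvg_harmonic R; rewrite -cvg_shiftS.
Qed.

Lemma powR_small_cvg0 a : 0 < a -> n.+2%:R^-1 `^ a * expR (- n.+2%:R^-1) @[n --> \oo] --> (0 : R).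
Proof.
move=> a0; apply: (squeeze_cvgr _ (cvg_cst 0) (powR_inv_cvg0 a0)).
apply: nearW => n; rewrite mulr_ge0 ?powR_ge0 ?expR_ge0 //=.
by rewrite ler_piMr ?powR_ge0 // expR_le1 oppr_le0 invr_ge0.
Qed.

(* From [t / m <= expR (t / m)] with [m = 2 * a]. *)
Lemma powR_expRN_le (a t : R) : 0 < a -> 0 < t ->
  t `^ a * expR (- t) <= (a + a) `^ (a + a) * t^-1 `^ a.
Proof.
move=> a0 t0; set m := a + a; have m0 : 0 < m by rewrite addr_gt0.
have le1 : expR (- t) <= m `^ m * t^-1 `^ m.
  rewrite -powRM ?invr_ge0 ?(ltW t0) ?(ltW m0) // (_ : expR (- t) = expR (- t / m) `^ m); last first.
    by rewrite -expRM divfK // gt_eqF.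
  apply: (ge0_ler_powR (ltW m0)); rewrite ?nnegrE ?expR_ge0 ?mulr_ge0 ?invr_ge0 ?(ltW t0) ?(ltW m0) //.
  rewrite mulNr expRN -[leRHS]invrK lef_pV2 ?posrE ?expR_gt0 ?invr_gt0 ?mulr_gt0 ?invr_gt0 //.
  by rewrite invfM invrK mulrC (le_trans _ (expR_ge1Dx _)) // lerDr.
apply: (@le_trans _ _ (t `^ a * (m `^ m * t^-1 `^ m))); first by rewrite ler_wpM2l ?powR_ge0.
rewrite mulrCA ler_wpM2l ?powR_ge0 // powRD; last by rewrite invr_eq0 (gt_eqF t0) implybT.
by rewrite mulrA -powRM ?invr_ge0 ?(ltW t0) ?(ltW m0) // divff ?gt_eqF // powR1 mul1r.
Qed.

Lemma powR_expRN_cvg0 a : 0 < a -> n.+2%:R `^ a * expR (- n.+2%:R) @[n --> \oo] --> (0 : R).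
Proof.
move=> a0.
apply: (squeeze_cvgr (f := cst 0) (h := fun n => (a + a) `^ (a + a) * n.+2%:R^-1 `^ a)).
- by apply: nearW => n; rewrite mulr_ge0 ?powR_ge0 ?expR_ge0 //= powR_expRN_le.
- exact: cvg_cst.
rewrite -[X in _ --> X](mulr0 ((a + a) `^ (a + a))).
by apply: cvgM; [exact: cvg_cst|exact: powR_inv_cvg0].
Qed.

Lemma gamma_parts (a u v : R) : 0 < a -> 0 < u -> u < v ->
  (\int[mu]_(t in `[u, v]) (gamma_fun (a + 1) t)%:E =
   a%:E * \int[mu]_(t in `[u, v]) (gamma_fun a t)%:E
   - (v `^ a * expR (- v) - u `^ a * expR (- u))%R%:E)%E.
Proof.
move=> a0 u0 uv.
pose F t : R := t `^ a.
pose f t : R := a * t `^ (a - 1).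
pose G (t : R) := expR (- t).
pose g (t : R) := - expR (- t).
have dF (x : R) : u <= x <= v -> is_derive x 1 F (f x).
  by move=> /andP[ux _]; apply: is_derive1_powR; apply: lt_le_trans ux.
have df (x : R) : u <= x <= v -> is_derive x 1 f (a * ((a - 1) * x `^ (a - 1 - 1))).
  by move=> /andP[ux _]; apply: is_deriveZ; apply: is_derive1_powR; apply: lt_le_trans ux.
have dG (y : R) : u <= y <= v -> is_derive y 1 G (g y).
  by move=> _; apply: is_derive_expRN.
have dg (y : R) : u <= y <= v -> is_derive y 1 g (- g y).
  by move=> _; apply: is_deriveN; exact: is_derive_expRN.
have dF1 (H k : R -> R) : (forall x : R, u <= x <= v -> is_derive x 1 H (k x)) ->
    {in `]u, v[%R, H^`() =1 k}.
  move=> dH y; rewrite in_itv /= => /andP[uy yv].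
  by rewrite derive1E; have [|_ ->] := dH y; rewrite ?ltW.
have := integration_by_parts uv (within_derive_continuous df) (is_derive_LR dF (ltW uv))
  (dF1 _ _ dF) (within_derive_continuous dg) (is_derive_LR dG (ltW uv)) (dF1 _ _ dG).
have -> : (\int[mu]_(x in `[u, v]) (F x * g x)%:E =
    - \int[mu]_(x in `[u, v]) (gamma_fun (a + 1) x)%:E)%E.
  rewrite -integral_ge0N => [|x _]; last by rewrite lee_fin gamma_fun_ge0.
  by apply: eq_integral => x _; rewrite -EFinN /F /g /gamma_fun addrK mulrN.
have -> : (\int[mu]_(x in `[u, v]) (f x * G x)%:E =
    a%:E * \int[mu]_(x in `[u, v]) (gamma_fun a x)%:E)%E.
  rewrite -ge0_integralZl //=.
  - by apply: eq_integral => x _; rewrite -EFinM /gamma_fun mulrA.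
  - by apply/measurable_EFinP; exact: measurable_gamma_fun.
  - by move=> x _; rewrite lee_fin gamma_fun_ge0.
  - by rewrite lee_fin ltW.
move=> /(congr1 oppe); rewrite oppeK => ->.
by rewrite addeC fin_num_oppeD // oppeK.
Qed.

(** Both boundary terms of [gamma_parts] vanish as the interval grows to the half-line. *)
Lemma eGammaS (a : R) : 0 < a -> eGamma (a + 1) = (a%:E * eGamma a)%E.
Proof.
move=> a0.
have lim1 := integral_exhaustX (k := 1) isT (fun t _ => gamma_fun_ge0 (a + 1) t) (@measurable_gamma_fun (a + 1) setT).
have lim0 := integral_exhaustX (k := 1) isT (fun t _ => gamma_fun_ge0 a t) (@measurable_gamma_fun a setT).
apply: (cvg_unique _ lim1) => //.
rewrite (_ : (fun n => _) = (fun n : nat =>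
    a%:E * \int[mu]_(t in `[(n.+2%:R^-1 ^+ 1)%R, (n.+2%:R ^+ 1)%R]) (gamma_fun a t)%:E
    - (n.+2%:R `^ a * expR (- n.+2%:R) - n.+2%:R^-1 `^ a * expR (- n.+2%:R^-1))%R%:E)%E); last first.
  apply/funext => n; rewrite !expr1 gamma_parts ?invr_gt0 //.
  by rewrite (@lt_trans _ _ 1) ?invf_lt1 ?ltr1n.
have cB : (n.+2%:R `^ a * expR (- n.+2%:R) - n.+2%:R^-1 `^ a * expR (- n.+2%:R^-1))%R%:E
    @[n --> \oo] --> 0%:E.
  apply: cvg_EFin; first exact: nearW.
  rewrite -(subrr 0).
  by apply: cvgB; [exact: powR_expRN_cvg0|exact: powR_small_cvg0].
have := cvgeB _ (cvgeZl (isT : a%:E \is a fin_num) lim0) cB.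
by rewrite sube0; apply; rewrite fin_num_adde_defl.
Qed.

Lemma integral_expRN : (\int[mu]_(t in `]0%R, +oo[) (expR (- t))%:E = 1)%E.
Proof.
have cE : continuous (fun t : R => expR (- t)).
  by move=> x; have [/derivable1_diffP/differentiable_continuous] := is_derive_expRN x.
rewrite integral_itv_obnd_cbnd; last first.
  by apply/measurable_EFinP; apply: measurable_funTS; apply: measurableT_comp.
rewrite (@ge0_continuous_FTC2y _ _ (fun t => - expR (- t)) 0 0).
- by rewrite oppr0 expR0 sub0e -EFinN opprK.
- by move=> x _; exact: expR_ge0.
- exact: continuous_subspaceT.
- by rewrite -oppr0; apply: cvgN; exact: cvgr_expR.
- by move=> x _; apply: derivableN; have [] := is_derive_expRN x.
- by apply: cvgN; apply: cvg_at_right_filter; exact: cE.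
- by move=> x _; rewrite derive1E; have [_] := is_deriveN (is_derive_expRN x); rewrite opprK.
Qed.

Lemma eGamma1 : eGamma 1 = 1%E.
Proof.
rewrite -integral_expRN; apply: eq_integral => t _.
by rewrite /gamma_fun subrr powRr0 mul1r.
Qed.

Lemma gamma_fun_half (x : R) : 0 < x ->
  gamma_fun 2^-1 (x ^+ 2) * (2 * x) = 2 * gauss_fun x.
Proof.
move=> x0; rewrite /gamma_fun /gauss_fun -powR_mulrn ?ltW // -powRrM.
rewrite (_ : 2 * (2^-1 - 1) = - 1) ?powR_inv1 ?ltW //; last by field.
by field; rewrite gt_eqF.
Qed.

(** The substitution t = x ^ 2 turns t ^ (- 1 / 2) exp (- t) dt into 2 exp (- x ^ 2) dx. *)
Lemma gauss_subst (u v : R) : 0 < u -> u < v ->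
  (\int[mu]_(t in `[(u ^+ 2)%R, (v ^+ 2)%R]) (gamma_fun 2^-1 t)%:E =
   2%:E * \int[mu]_(x in `[u, v]) (gauss_fun x)%:E)%E.
Proof.
move=> u0 uv.
pose F (x : R) := x ^+ 2.
have dF (x : R) : is_derive x 1 F (2 * x).
  split; first exact: exprn_derivable.
  by rewrite exp_derive expr1 [LHS]mulr1.
have FE : F^`() = (fun x => 2 * x).
  by apply/funext => x; rewrite derive1E; have [] := dF x.
have cF : continuous (fun x : R => 2 * x).
  by move=> x; apply: cvgM; [exact: cvg_cst|exact: cvg_id].
rewrite (@integration_by_substitution_increasing _ F (gamma_fun 2^-1) u v) ?FE //.
- rewrite -ge0_integralZl //=.
  + apply: eq_integral => x /=; rewrite inE /= in_itv /= => /andP[ux _].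
    by rewrite -EFinM -gamma_fun_half // (lt_le_trans u0).
  + by apply/measurable_EFinP; apply: measurable_funTS; exact: measurable_gauss_fun.
  + by move=> x _; rewrite lee_fin gauss_fun_ge0.
- exact: ltW.
- move=> x y; rewrite !in_itv /= => /andP[ux _] _ xy.
  by rewrite ltrXn2r // ?nnegrE; lra.
- by apply/cvg_ex; exists (2 * u); apply: cvg_at_right_filter; exact: cF.
- by apply/cvg_ex; exists (2 * v); apply: cvg_at_left_filter; exact: cF.
- exact: is_derive_LR (fun x _ => dF x) (ltW uv).
apply: derivable_within_continuous => x; rewrite in_itv /= => /andP[ux _].
have x0 : 0 < x by rewrite (lt_le_trans _ ux) // exprn_gt0.
apply: derivableM; first by apply: derivable_powR; rewrite in_itv /= x0.
by have [] := is_derive_expRN x.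
Qed.

Lemma eGamma_half : eGamma 2^-1 = (Num.sqrt pi)%:E.
Proof.
have lim1 := integral_exhaustX (k := 2) isT (fun t _ => gamma_fun_ge0 2^-1 t) (@measurable_gamma_fun 2^-1 setT).
have lim0 := integral_exhaustX (k := 1) isT (fun t _ => gauss_fun_ge0 t) (@measurable_gauss_fun R).
apply: (cvg_unique _ lim1) => //.
rewrite (_ : (fun n => _) = (fun n : nat =>
    2%:E * \int[mu]_(t in `[(n.+2%:R^-1 ^+ 1)%R, (n.+2%:R ^+ 1)%R]) (gauss_fun t)%:E)%E); last first.
  apply/funext => n; rewrite gauss_subst ?expr1 ?invr_gt0 //.
  by rewrite (@lt_trans _ _ 1) ?invf_lt1 ?ltr1n.
rewrite (_ : (Num.sqrt pi)%:E = 2%:E * \int[mu]_(t in `]0%R, +oo[) (gauss_fun t)%:E)%E.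
  exact: cvgeZl lim0.
rewrite integral_itv_obnd_cbnd; last first.
  by apply/measurable_EFinP; apply: measurable_funTS; exact: measurable_gauss_fun.
by rewrite integral0y_gauss -EFinM mulrC divfK.
Qed.

End Gamma.

(** * Bohr-Mollerup inequalities and Gauss's limit *)

Section Gamma_limit.
Variable R : realType.
Notation mu := (@lebesgue_measure R).
Implicit Types (a s t x : R).

(** Weighted mean inequality for 1 and y: add ln z <= z - 1 at z = 1 / m and z = y / m with weights
    1 - s and s, where m is the right-hand side. *)
Lemma powR_le_affine s y : 0 <= s <= 1 -> 0 < y -> y `^ s <= 1 - s + s * y.
Proof.
move=> /andP[s0 s1] y0; set m := 1 - s + s * y.
have m0 : 0 < m by rewrite /m; nra.
have lnm : ln m^-1 <= m^-1 - 1.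
  by rewrite -[X in ln X](addrNK 1) addrC le_ln1Dx // ltrBrDr addNr invr_gt0.
have lny : ln (y / m) <= y / m - 1.
  by rewrite -[X in ln X](addrNK 1) addrC le_ln1Dx // ltrBrDr addNr divr_gt0.
rewrite lnV ?posrE // in lnm; rewrite ln_div ?posrE // in lny.
have mE : (1 - s) * (m^-1 - 1) + s * (y / m - 1) = 0.
  by rewrite /m; field; rewrite -/m gt_eqF.
rewrite /powR (gt_eqF y0) -[leRHS]lnK ?posrE // ler_expR.
nra.
Qed.

(* Integrate [t `^ s <= a `^ s * (1 - s + s * (t / a))], and use [eGammaS]. *)
Lemma eGammaD_le a s : 0 < a -> 0 <= s <= 1 -> (eGamma (a + s) <= (a `^ s)%:E * eGamma a)%E.
Proof.
move=> a0 s01; have /andP[s0 s1] := s01.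
have -> : ((a `^ s)%:E * eGamma a = (a `^ s * (1 - s))%:E * eGamma a + (a `^ s * s / a)%:E * eGamma (a + 1))%E.
  rewrite eGammaS // muleA -EFinM divfK ?gt_eqF // -ge0_muleDl ?lee_fin ?mulr_ge0 ?powR_ge0 ?subr_ge0 //.
  by rewrite -EFinD -mulrDr subrK mulr1.
have g0 b t : (0 <= (gamma_fun b t)%:E)%E by rewrite lee_fin gamma_fun_ge0.
pose D : set R := `]0%R, +oo[.
have mg b : measurable_fun D (fun t => (gamma_fun b t)%:E).
  by apply/measurable_EFinP; exact: measurable_gamma_fun.
have c1 : 0 <= a `^ s * (1 - s) by rewrite mulr_ge0 ?powR_ge0 ?subr_ge0.
have c2 : 0 <= a `^ s * s / a by rewrite !mulr_ge0 ?powR_ge0 ?invr_ge0 ?(ltW a0).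
have mD : measurable D by exact: measurable_itv.
have mZ c b : measurable_fun D (fun t => c%:E * (gamma_fun b t)%:E)%E.
  by apply: measurable_funeM.
rewrite /eGamma -/D -!ge0_integralZl ?lee_fin //; try exact: mg.
have Z0 c b : 0 <= c -> forall t, D t -> (0 <= c%:E * (gamma_fun b t)%:E)%E.
  by move=> c0 t _; rewrite mule_ge0.
have /= intD := ge0_integralD mu mD (Z0 _ a c1) (mZ _ _) (Z0 _ (a + 1) c2) (mZ _ _).
rewrite -intD.
apply: ge0_le_integral => //; [exact: mg|by apply: emeasurable_funD; exact: mZ|].
move=> t; rewrite /D /= in_itv /= andbT => t0.
rewrite -!EFinM -EFinD lee_fin /gamma_fun !mulrA -mulrDl ler_wpM2r ?expR_ge0 //.
have ta : t = t / a * a by rewrite divfK // gt_eqF.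
have -> : t `^ (a + s - 1) = t `^ (a - 1) * t `^ s.
  by rewrite -powRD ?(gt_eqF t0) ?implybT // addrAC.
have -> : t `^ s = a `^ s * (t / a) `^ s.
  by rewrite -powRM ?divr_ge0 ?(ltW a0) ?(ltW t0) // mulrC divfK ?gt_eqF.
have -> : t `^ (a + 1 - 1) = t * t `^ (a - 1).
  by rewrite mulr_powRB1 ?addrK // ltW.
rewrite [leRHS](_ : _ = t `^ (a - 1) * (a `^ s * (1 - s + s * (t / a)))); last by field; rewrite gt_eqF.
by rewrite !ler_wpM2l ?powR_ge0 // powR_le_affine // divr_gt0.
Qed.

(** For a <= 1, [eGammaD_le] bounds the value at 1 + a by that at 1, and the functional equation
    passes down to a; larger a are reached by unit steps. *)
Lemma eGamma_lty a : 0 < a -> (eGamma a < +oo)%E.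
Proof.
have lt01 a' : 0 < a' -> (eGamma (a' + 1) < +oo)%E -> (eGamma a' < +oo)%E.
  move=> a0; rewrite eGammaS // !ltey; apply: contra => /eqP ->.
  by rewrite gt0_muley // lte_fin.
move=> a0; have := ltW (archi_boundP (ltW a0)); move: (Num.bound a) => n.
elim: n a a0 => [|n IHn] a a0 an; first by have := lt_le_trans a0 an; rewrite ltxx.
have [a1|a1] := leP a 1.
  apply: lt01 => //; rewrite addrC (le_lt_trans (eGammaD_le _ _)) ?a1 ?ltW //.
  by rewrite powR1 eGamma1 mule1 ltry.
have b0 : 0 < a - 1 by rewrite subr_gt0.
rewrite -(subrK 1 a) eGammaS // lte_mul_pinfty ?lee_fin ?(ltW b0) //.
by apply: IHn => //; rewrite lerBlDr natr1.
Qed.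

Lemma eGammaEFin a : 0 < a -> eGamma a = (Gamma a)%:E.
Proof.
by move=> a0; rewrite GammaE fineK // ge0_fin_numE ?eGamma_ge0 // eGamma_lty.
Qed.

Lemma GammaS a : 0 < a -> Gamma (a + 1) = a * Gamma a.
Proof. by move=> a0; apply: EFin_inj; rewrite EFinM -!eGammaEFin ?addr_gt0 // eGammaS. Qed.

Lemma GammaD_le a s : 0 < a -> 0 <= s <= 1 -> Gamma (a + s) <= a `^ s * Gamma a.
Proof.
move=> a0 s01; have /andP[s0 _] := s01.
by rewrite -lee_fin EFinM -!eGammaEFin ?eGammaD_le // ltr_wpDr.
Qed.

Lemma Gamma1 : Gamma 1 = 1 :> R.
Proof. by rewrite GammaE eGamma1. Qed.

Lemma Gamma_half : Gamma 2^-1 = Num.sqrt pi :> R.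
Proof. by rewrite GammaE eGamma_half. Qed.

Lemma GammaDn s n : 0 < s -> Gamma (n%:R + s) = (\prod_(0 <= j < n) (j%:R + s)) * Gamma s.
Proof.
move=> s0; elim: n => [|n IHn]; first by rewrite big_nil add0r mul1r.
rewrite -natr1 addrAC GammaS ?ltr_wpDl // IHn big_nat_recr //=; ring.
Qed.

(** Compare with Gamma 1 = 1 through [GammaD_le] at s with exponent 1 - s. *)
Lemma Gamma_gt0 s : 0 < s <= 1 -> 0 < Gamma s.
Proof.
move=> /andP[s0 s1].
have s1' : 0 <= 1 - s <= 1 by apply/andP; split; lra.
have := GammaD_le s0 s1'; rewrite (_ : s + (1 - s) = 1); last by ring.
rewrite Gamma1 => /(lt_le_trans ltr01).
by rewrite pmulr_rgt0 // powR_gt0.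
Qed.

Lemma prod_shift_gt0 s n : 0 < s -> 0 < \prod_(0 <= j < n) (j%:R + s).
Proof. by move=> s0; apply: prodr_gt0 => j _; rewrite ltr_wpDl. Qed.

(* Bohr-Mollerup: [GammaD_le] at [n.+1] with exponent [s], and at [n.+1 + s] with
   exponent [1 - s], squeezes the ratio. *)
Lemma Gamma_ratio_cvg s : 0 < s <= 1 ->
  Gamma (n.+1%:R + s) / (Gamma n.+1%:R * n.+1%:R `^ s) @[n --> \oo] --> (1 : R).
Proof.
move=> /andP[s0 s1].
have cvg1 : 1 - n.+1%:R^-1 @[n --> \oo] --> (1 : R).
  rewrite -[X in _ --> X]subr0; apply: cvgB; first exact: cvg_cst.
  exact: cvg_harmonic.
apply: (squeeze_cvgr (f := fun n => 1 - n.+1%:R^-1) (h := cst 1)) => //; last exact: cvg_cst.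
apply: nearW => n /=.
have G0 : 0 < Gamma n.+1%:R :> R.
  by rewrite -natr1 GammaDn // Gamma1 mulr1 prod_shift_gt0.
have Gs0 : 0 < Gamma (n.+1%:R + s) by rewrite GammaDn // mulr_gt0 ?prod_shift_gt0 ?Gamma_gt0 ?s0.
have n0 : 0 < n.+1%:R :> R by [].
have ns0 : 0 < n.+1%:R + s by rewrite addr_gt0.
have c0 : 0 < Gamma n.+1%:R * n.+1%:R `^ s by rewrite mulr_gt0 ?powR_gt0.
apply/andP; split; last first.
  by rewrite ler_pdivrMr // mul1r mulrC GammaD_le // ltW.
rewrite ler_pdivlMr //.
(* With m = n + 1, read Gamma (m + 1) as Gamma ((m + s) + (1 - s)). *)
have le1 : n.+1%:R * Gamma n.+1%:R <= (n.+1%:R + s) `^ (1 - s) * Gamma (n.+1%:R + s).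
  rewrite -GammaS // (le_trans _ (GammaD_le ns0 _)) //; last by rewrite subr_ge0 s1 gerBl ltW.
  by rewrite -addrA [s + _]addrC subrK.
have r0 : 0 < n.+1%:R / (n.+1%:R + s) by rewrite divr_gt0.
have le2 : n.+1%:R / (n.+1%:R + s) <= (n.+1%:R / (n.+1%:R + s)) `^ (1 - s).
  by rewrite ger1_powR ?r0 ?gerBl ?(ltW s0) // ler_pdivrMr // mul1r lerDl ltW.
have le3 : 1 - n.+1%:R^-1 <= n.+1%:R / (n.+1%:R + s).
  rewrite ler_pdivlMr // mulrBl mul1r lerBlDr lerD2l mulrDr mulVf ?gt_eqF //.
  rewrite (le_trans s1) // lerDl mulr_ge0 ?invr_ge0 // ltW //.
have nE : n.+1%:R `^ s * n.+1%:R `^ (1 - s) = n.+1%:R :> R.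
  by rewrite -powRD ?(gt_eqF n0) ?implybT // addrC subrK powRr1 // ltW.
have le4 : n.+1%:R `^ s * (1 - n.+1%:R^-1) * (n.+1%:R + s) `^ (1 - s) <= n.+1%:R.
  rewrite -ler_pdivlMr ?powR_gt0 // -{3}nE -mulrA ler_pM2l ?powR_gt0 //.
  rewrite (le_trans le3) // (le_trans le2) // powRM ?invr_ge0 ?(ltW n0) ?(ltW ns0) //.
  by rewrite -powR_inv1 ?(ltW ns0) // powRAC powR_inv1 ?powR_ge0.
rewrite -(ler_pM2l (powR_gt0 (1 - s) ns0)); apply: le_trans le1.
move: G0 le4 {le2 le3 Gs0 c0 r0}; move: (Gamma n.+1%:R) (n.+1%:R `^ s) ((n.+1%:R + s) `^ (1 - s)).
move=> G A M G0 le4; have := ler_wpM2r (ltW G0) le4.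
by congr (_ <= _); ring.
Qed.

(** Since 1 - x / (2 j + 1) = (j + s) / (j + 1 / 2) with s = (1 - x) / 2, [GammaDn] turns the
    product into Gamma values; the power of n + 1 comes from s - 1 / 2 = - x / 2. *)
Lemma odd_prod_cvg (x : R) : `|x| < 1 ->
  n.+1%:R `^ (- (x / 2)) * \prod_(0 <= j < n.+1) (1 - x / j.*2.+1%:R)^-1 @[n --> \oo]
  --> pi `^ (- 2^-1) * Gamma ((1 - x) / 2).
Proof.
rewrite ltr_norml => /andP[x1 x2]; set s := (1 - x) / 2.
have s01 : 0 < s <= 1 by rewrite /s; apply/andP; split; lra.
have h01 : 0 < (2^-1 : R) <= 1 by apply/andP; split; lra.
rewrite (_ : (fun n => _) = (fun n => pi `^ (- 2^-1) * Gamma s *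
    (Gamma (n.+1%:R + 2^-1) / (Gamma n.+1%:R * n.+1%:R `^ 2^-1) *
    (Gamma (n.+1%:R + s) / (Gamma n.+1%:R * n.+1%:R `^ s))^-1))).
  rewrite -[X in _ --> X]mulr1; apply: cvgM; first exact: cvg_cst.
  rewrite -[X in _ --> X]mulr1; apply: cvgM; first exact: Gamma_ratio_cvg.
  by rewrite -[X in _ --> X]invr1; apply: cvgV; [exact: oner_neq0|exact: Gamma_ratio_cvg].
apply/funext => n.
have [s0 _] := andP s01; have [h0 _] := andP h01.
have -> : \prod_(0 <= j < n.+1) (1 - x / j.*2.+1%:R)^-1 =
   (\prod_(0 <= j < n.+1) (j%:R + 2^-1)) / \prod_(0 <= j < n.+1) (j%:R + s).
  rewrite -prodf_div; apply: eq_bigr => j _; rewrite -invf_div; congr (_^-1).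
  have j0 : 0 <= j%:R :> R by [].
  rewrite /s -addn1 -muln2 natrD natrM; field.
  by rewrite !gt_eqF //; lra.
rewrite !GammaDn // Gamma_half.
have Gs0 := Gamma_gt0 s01; have pi0 : 0 < Num.sqrt pi :> R by rewrite sqrtr_gt0 pi_gt0.
have G0 : 0 < Gamma n.+1%:R :> R.
  by rewrite -natr1 GammaDn // Gamma1 mulr1 prod_shift_gt0.
have n0 : 0 < n.+1%:R :> R by [].
have -> : n.+1%:R `^ (- (x / 2)) = n.+1%:R `^ s / n.+1%:R `^ 2^-1 :> R.
  by rewrite -powRB ?(gt_eqF n0) ?implybT //; congr (_ `^ _); rewrite /s; lra.
rewrite powRN (powR12_sqrt (pi_ge0 R)).
have := prod_shift_gt0 n.+1 s0; have := prod_shift_gt0 n.+1 h0.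
have := powR_gt0 s n0; have := powR_gt0 2^-1 n0.
move: (n.+1%:R `^ s) (n.+1%:R `^ 2^-1) (\prod_(_ <= _ < _) _) (\prod_(_ <= _ < _) _) => A B C D A0 B0 C0 D0.
by field; rewrite !gt_eqF.
Qed.

End Gamma_limit.

(** * Generating functions *)

Section Euler.
Variable R : realType.

Let u (n : nat) : R := series harmonic n - ln n%:R.

Lemma lnS_le n : ln n.+1%:R <= series harmonic n :> R.
Proof.
elim: n => [|n IHn]; first by rewrite ln1 /series /= big_geq.
rewrite seriesSr; apply: le_trans (lerD IHn (lexx _)).
have -> : n.+2%:R = n.+1%:R * (1 + n.+1%:R^-1) :> R.
  by rewrite mulrDr divff // mulr1 natr1.
rewrite lnM ?posrE ?addr_gt0 ?invr_gt0 // lerD2l le_ln1Dx //.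
by rewrite (@lt_trans _ _ 0) ?invr_gt0 ?ltrN10.
Qed.

(** From index 1 on, which avoids the default value of [ln] at 0, the sequence decreases since ln (1
    - 1 / m) <= - 1 / m, and [lnS_le] bounds it below by 0. *)
Lemma euler_gamma_cvg : u n @[n --> \oo] --> euler_gamma R.
Proof.
suff /cvg_ex[l ul] : cvgn (fun n => u n.+1).
  have ul' : u n @[n --> \oo] --> l by rewrite -(cvg_shiftS u).
  by rewrite /euler_gamma -/u (cvg_lim _ ul').
apply: nonincreasing_is_cvgn.
  apply/nonincreasing_seqP => n; rewrite /u seriesSr.
  have -> : ln n.+1%:R = ln n.+2%:R + ln (1 - n.+2%:R^-1) :> R.
    have -> : n.+1%:R = n.+2%:R * (1 - n.+2%:R^-1) :> R.
      by rewrite mulrBr divff // mulr1 -[in RHS]natr1 addrK.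
    rewrite lnM ?posrE // subr_gt0 invf_lt1 ?ltr1n //.
  have : ln (1 - n.+2%:R^-1) <= - n.+2%:R^-1 :> R.
    by rewrite le_ln1Dx // ltrN2 invf_lt1 ?ltr1n.
  rewrite (_ : harmonic n.+1 = n.+2%:R^-1) //; move: (n.+2%:R^-1) (series _ _) (ln n.+2%:R) => c H L.
  by move: (ln _) => M; lra.
exists 0 => _ [n _ <-]; rewrite subr_ge0 (le_trans _ (lnS_le _)) //.
by rewrite ler_ln ?posrE // ler_nat.
Qed.

Lemma odd_harmonic n :
  \sum_(0 <= j < n) j.*2.+1%:R^-1 = series harmonic n.*2 - series harmonic n / 2 :> R.
Proof.
elim: n => [|n IHn]; first by rewrite /series /= !big_geq // mul0r subr0.
rewrite big_nat_recr //= doubleS !seriesSr IHn /harmonic /=.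
have -> : n.*2.+2%:R = 2 * n.+1%:R :> R by rewrite -natrM mul2n.
by field; rewrite !gt_eqF.
Qed.

(** With m = n + 1 the expression is u_(2 m) - u_m / 2 + ln 2 - gamma / 2; this is the source of the
    value ln 2 at z_1. *)
Lemma odd_harmonic_cvg :
  \sum_(0 <= j < n.+1) j.*2.+1%:R^-1 - (ln n.+1%:R + euler_gamma R) / 2 @[n --> \oo]
  --> ln 2.
Proof.
have u1 : u n.+1 @[n --> \oo] --> euler_gamma R.
  by rewrite (cvg_shiftS u); exact: euler_gamma_cvg.
have u2 : u (2 * n.+1)%N @[n --> \oo] --> euler_gamma R.
  rewrite (cvg_shiftS (fun n => u (2 * n)%N)).
  exact: cvg_comp (@cvg_mulnl 2 isT) euler_gamma_cvg.
rewrite (_ : (fun n => _) =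
    (fun n => u (2 * n.+1)%N - u n.+1 * 2^-1 + (ln 2 - euler_gamma R / 2))).
  rewrite [X in _ --> X](_ : _ = euler_gamma R - euler_gamma R * 2^-1 + (ln 2 - euler_gamma R / 2)); last by field.
  apply: cvgD; last exact: cvg_cst.
  by apply: (cvgB u2); apply: (cvgM u1); exact: cvg_cst.
apply/funext => n; rewrite odd_harmonic /u natrM lnM ?posrE // mul2n.
by field.
Qed.

End Euler.

(** * Newton's recursion and limits of generating functions *)

Section newton.
Variable R : realType.
Implicit Types (p a b : R^nat) (x r d S : R).

(* [p k] is the power sum of degree [k.+1]. *)
Definition newton p a : Prop :=
  a 0%N = 1 /\ forall n, n.+1%:R * a n.+1 = \sum_(k < n.+1) p k * a (n - k)%N.

(** Each of the n + 1 terms of the recursion is at most B (1 + B) ^ n, and the factor n + 1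
    cancels. *)
Lemma newton_bound p a (B : R) : newton p a -> (forall k, `|p k| <= B) ->
  forall n, `|a n| <= (1 + B) ^+ n.
Proof.
move=> [a0 aS] pB n; have B0 : 0 <= B by rewrite (le_trans _ (pB 0%N)).
have B1 : 1 <= 1 + B by rewrite lerDl.
elim/ltn_ind: n => -[_|n IHn]; first by rewrite a0 normr1.
rewrite -(ler_pM2l (_ : 0 < n.+1%:R)) // -{1}[n.+1%:R]ger0_norm // -normrM aS.
rewrite (le_trans (ler_norm_sum _ _ _)) //.
apply: (@le_trans _ _ (\sum_(k < n.+1) B * (1 + B) ^+ n)).
  apply: ler_sum => k _; rewrite normrM ler_pM // (le_trans (IHn _ _)) ?ltnS ?leq_subr //.
  by rewrite ler_weXn2l ?leq_subr.
rewrite sumr_const card_ord -[leLHS]mulr_natl ler_wpM2l // exprS ler_wpM2r ?exprn_ge0 ?addr_ge0 //.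
by rewrite lerDr.
Qed.

(** The recursion makes a_n a polynomial in the first n power sums. *)
Lemma newton_cvg (P A : nat -> R^nat) p a :
  (forall N, newton (P N) (A N)) -> newton p a ->
  (forall k, P N k @[N --> \oo] --> p k) ->
  forall n, A N n @[N --> \oo] --> a n.
Proof.
move=> PA [a0 aS] Pp; elim/ltn_ind => -[_|n IHn].
  rewrite a0 (_ : (fun N => A N 0%N) = cst 1); first exact: cvg_cst.
  by apply/funext => N; have [] := PA N.
have -> : a n.+1 = n.+1%:R^-1 * \sum_(k <- index_enum 'I_n.+1) p k * a (n - k)%N.
  by rewrite -aS mulKf.
rewrite (_ : (fun N => A N n.+1) =
    (fun N => n.+1%:R^-1 * \sum_(k <- index_enum 'I_n.+1) P N k * A N (n - k)%N)).
  apply: cvgM; first exact: cvg_cst.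
  apply: (cvg_sum_seq (f := fun (k : 'I_n.+1) N => P N k * A N (n - k)%N)) => k _.
  by apply: cvgM; [exact: Pp|apply: IHn; rewrite ltnS leq_subr].
by apply/funext => N; have [_ AS] := PA N; rewrite -AS mulKf.
Qed.

(* Multiplies the generating function of [a] by [1 - r * x]. *)
Definition deflate r a : R^nat := fun n => if n is m.+1 then a m.+1 - r * a m else a 0%N.

(** The factor 1 - r x removes the variable r, hence r ^ (k + 1) from the power sums. [T]
    telescopes, and [Q] combines the recursion for [a] at n + 1 and at n. *)
Lemma newton_deflate p a r : newton p a ->
  newton (fun k => p k - r ^+ k.+1) (deflate r a).
Proof.
move=> [a0 aS]; split=> // n.
have E m : m.+1%:R * a m.+1 = \sum_(0 <= k < m.+1) p k * a (m - k)%N by rewrite big_mkord.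
have T : \sum_(0 <= k < n.+1) r ^+ k.+1 * deflate r a (n - k)%N = r * a n.
  rewrite big_nat_recr //= subnn.
  rewrite (telescope_sumr_eq (fun k => - (r ^+ k.+1 * a (n - k)%N))) => [|//|k /andP[_ kn]].
    by rewrite subn0 subnn opprK expr1 /=; ring.
  rewrite subnS; case: (n - k)%N (subn_gt0 k n) => [|m]; rewrite ?kn //= => _.
  by rewrite !exprS; ring.
have Q : \sum_(0 <= k < n.+1) p k * deflate r a (n - k)%N = n.+1%:R * a n.+1 - r * (n%:R * a n).
  rewrite E big_nat_recr //= [in RHS]big_nat_recr //= subnn /=.
  have -> : n%:R * a n = \sum_(0 <= k < n) p k * a (n - k.+1)%N.
    case: (n) => [|m]; first by rewrite mul0r big_geq.
    by rewrite E; apply: eq_bigr => k _; rewrite subSS.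
  rewrite mulr_sumr addrAC -sumrB; congr (_ + _); apply: eq_big_nat => k /andP[_ kn].
  by rewrite subnS; case: (n - k)%N (subn_gt0 k n) => [|m]; rewrite ?kn //= => _; ring.
rewrite -(big_mkord xpredT (fun k => (p k - r ^+ k.+1) * deflate r a (n - k)%N)).
under eq_bigr do rewrite mulrBl.
by rewrite sumrB T Q /= -[n.+1%:R]natr1; ring.
Qed.

Lemma newton_const p a d : newton p a -> (forall k, p k = d * (k == 0)%:R) ->
  forall n, a n = d ^+ n / n`!%:R.
Proof.
move=> [a0 aS] pE; elim=> [|n IHn]; first by rewrite a0 expr0 divr1.
apply: (@mulfI _ n.+1%:R); first by rewrite pnatr_eq0.
rewrite aS big_ord_recl /= big1 => [|k _]; last by rewrite pE mulr0 mul0r.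
rewrite pE subn0 IHn factS natrM exprS. rewrite eqxx mulr1 addr0; field.
by rewrite nat1r !pnatr_eq0 -lt0n fact_gt0.
Qed.

Lemma series_deflate a r x n : series (fun k => deflate r a k * x ^+ k) n.+1 =
  series (fun k => a k * x ^+ k) n.+1 - r * x * series (fun k => a k * x ^+ k) n.
Proof.
elim: n => [|n IHn]; first by rewrite /series /= !big_nat1 big_geq // mulr0 subr0.
rewrite seriesSr IHn [in RHS]seriesSr [X in _ = _ - _ * X]seriesSr /= exprS; ring.
Qed.

(** Deflating by the elements of [rs] one at a time leaves the series of exp (d x). The identity is
    multiplied out, so that nothing is divided by. *)
Lemma newton_product (rs : seq R) p a d x (S : R) : newton p a ->
  (forall k, p k = d * (k == 0)%:R + \sum_(r <- rs) r ^+ k.+1) ->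
  series (fun n => a n * x ^+ n) n @[n --> \oo] --> S ->
  S * \prod_(r <- rs) (1 - r * x) = expR (d * x).
Proof.
elim: rs p a S => [|r rs IHrs] p a S pa pE aS.
  rewrite big_nil mulr1.
  have aE := newton_const pa (fun k => etrans (pE k) (_ : _ = d * (k == 0)%:R)).
  have {}aE : (fun n => a n * x ^+ n) = exp_coeff (d * x).
    apply/funext => n; rewrite aE => [|k]; last by rewrite big_nil addr0.
    by rewrite /exp_coeff /= exprMn; ring.
  by rewrite -(cvg_lim _ aS) // aE.
rewrite big_cons mulrA; apply: (IHrs _ _ _ (newton_deflate r pa)) => [k|].
  by rewrite pE big_cons; ring.
rewrite -(cvg_shiftS (series _)).
rewrite (_ : (fun n => _) = (fun n => series (fun k => a k * x ^+ k) n.+1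
   - r * x * series (fun k => a k * x ^+ k) n)); last first.
  by apply/funext => n; exact: series_deflate.
rewrite (_ : S * _ = S - r * x * S); last by ring.
apply: cvgB; first by rewrite (cvg_shiftS (series _)).
by apply: cvgM => //; exact: cvg_cst.
Qed.

Lemma geometric_half_tail (u : R^nat) (S : R) m : (forall n, `|u n| <= 2^-1 ^+ n) ->
  series u n @[n --> \oo] --> S -> `|S - series u m| <= 2 * 2^-1 ^+ m.
Proof.
move=> ub uS.
have le n : `|series u (m + n)%N - series u m| <= 2 * 2^-1 ^+ m - 2 * 2^-1 ^+ (m + n).
  elim: n => [|n IHn]; first by rewrite addn0 !subrr normr0.
  rewrite addnS seriesSr addrAC (le_trans (ler_normD _ _)) //.
  rewrite (le_trans (lerD IHn (ub _))) // exprS; lra.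
have cv : `|series u n - series u m| @[n --> \oo] --> `|S - series u m|.
  by apply: cvg_norm; apply: cvgB => //; exact: cvg_cst.
rewrite -(cvg_lim _ cv) //; apply: limr_le; first by apply/cvg_ex; eexists; exact: cv.
near=> n; have mn : (m <= n)%N by near: n; exact: nbhs_infty_ge.
rewrite -(subnKC mn) (le_trans (le _)) // gerBl mulr_ge0 // exprn_ge0 //.
Unshelve. all: by end_near. Qed.

Lemma is_cvg_series_half (u : R^nat) : (forall n, `|u n| <= 2^-1 ^+ n) -> cvgn (series u).
Proof.
move=> ub; apply: normed_cvg; apply: (series_le_cvg (fun n => normr_ge0 (u n)) _ ub).
  by move=> n; rewrite exprn_ge0.
have := @is_cvg_geometric_series R 1 2^-1; rewrite ger0_norm // => /(_ _).
rewrite (_ : series (geometric 1 2^-1) = series (fun n => 2^-1 ^+ n)); last first.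
  by congr series; apply/funext => n /=; rewrite mul1r.
by apply; rewrite invf_lt1 ?ltr1n.
Qed.

(** Dominated convergence for series: the geometric bound makes the tails uniformly small, and
    finitely many terms converge. *)
Lemma tannery (u : nat -> R^nat) (v : R^nat) (S : R^nat) :
  (forall N n, `|u N n| <= 2^-1 ^+ n) -> (forall n, u N n @[N --> \oo] --> v n) ->
  (forall N, series (u N) n @[n --> \oo] --> S N) ->
  (exists2 T : R, series v n @[n --> \oo] --> T & S N @[N --> \oo] --> T).
Proof.
move=> ub uv uS.
have vb n : `|v n| <= 2^-1 ^+ n.
  have cv : `|u N n| @[N --> \oo] --> `|v n| by apply: cvg_norm.
  rewrite -(cvg_lim _ cv) //; apply: limr_le; first by apply/cvg_ex; eexists; exact: cv.
  exact: nearW.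
have /cvg_ex[T vT] := is_cvg_series_half vb; exists T => //.
apply/cvgrPdist_le => e e0.
(* A quarter of e for each of the two tails leaves e / 2 for the partial sums. *)
have [m me] : exists m, 2 * 2^-1 ^+ m <= e / 4.
  have := @cvg_geometric R 2 2^-1; rewrite ger0_norm // invf_lt1 ?ltr1n // => /(_ isT).
  move=> /cvgrPdist_le /(_ (e / 4)) []; first by rewrite divr_gt0.
  move=> m _ /(_ m (leqnn _)); rewrite sub0r normrN /= => hm; exists m.
  exact: le_trans (ler_norm _) hm.
have cvm : series (u N) m @[N --> \oo] --> series v m.
  rewrite /series /=.
  by apply: (cvg_sum_seq (f := fun k N => u N k)) => k _; exact: uv.
have /cvgrPdist_le /(_ (e / 2)) := cvm => /(_ _)[|N0 _ close]; first by rewrite divr_gt0.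
exists N0 => // N /close /= cN.
have t1 := geometric_half_tail m vb vT.
have t2 := geometric_half_tail m (ub N) (uS N).
rewrite (_ : T - S N = (T - series v m) + (series v m - series (u N) m) - (S N - series (u N) m)); last by ring.
rewrite (le_trans (ler_normB _ _)) // (le_trans (lerD (ler_normD _ _) (lexx _))) //.
by move: (`|_|) (`|_|) (`|_|) t1 t2 cN; move=> A B C; lra.
Qed.

End newton.

(** * Generating functions attached to homomorphisms on H1 *)

Section theta.
Variable R : realType.
Implicit Type theta : {lrmorphism H1 -> R | (@ratr R) \; *%R}.

Lemma lrmorphism_ext theta a : theta a = ext (fun w => theta (of_word w)) a.
Proof.
elim/H1_ind: a => [|k w a IHa]; first by rewrite raddf0 ext0.
by rewrite raddfD /= linearZ_LR /= IHa extD extZ ext_word.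
Qed.

Lemma newton_lrmorphism theta :
  newton (fun k => theta (of_word [:: letterS k])) (fun n => theta (h n)).
Proof.
split=> [|n]; first by rewrite h0 rmorph1.
rewrite mulr_natl -raddfMn newton_h raddf_sum; apply: eq_bigr => k _.
by rewrite /= rmorphM subSS.
Qed.

(* Subtracting the divergent part turns the limit of the exponential factor of the
   generating function into the power of [N] of Gauss's limit. *)
Definition trunc_z1 N : R :=
  \sum_(0 <= j < N.+1) j.*2.+1%:R^-1 - (ln N.+1%:R + euler_gamma R) / 2.

Lemma bounded_of_cvg (u : R^nat) (l : R) :
  u n @[n --> \oo] --> l -> exists B, forall n, `|u n| <= B.
Proof.
move=> ul; have : cvgn u by apply/cvg_ex; exists l.
move=> /cvg_seq_bounded [M [_ Mu]]; exists (M + 1) => n.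
by apply: Mu => //; rewrite ltrDl.
Qed.

Lemma gamma_product_cvg (x : R) : `|x| < 1 ->
  expR (- ((ln N.+1%:R + euler_gamma R) / 2) * x) *
    \prod_(0 <= j < N.+1) (1 - x / j.*2.+1%:R)^-1 @[N --> \oo]
  --> pi `^ (- 2^-1) * expR (- (euler_gamma R * x / 2)) * Gamma ((1 - x) / 2).
Proof.
move=> x1.
rewrite (_ : (fun N => _) = (fun N => expR (- (euler_gamma R * x / 2)) *
  (N.+1%:R `^ (- (x / 2)) * \prod_(0 <= j < N.+1) (1 - x / j.*2.+1%:R)^-1))).
  rewrite [X in _ --> X](_ : _ = expR (- (euler_gamma R * x / 2)) *
    (pi `^ (- 2^-1) * Gamma ((1 - x) / 2))); last by ring.
  exact: (cvgM (cvg_cst _) (odd_prod_cvg x1)).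
apply/funext => N; rewrite mulrA; congr (_ * _).
by rewrite /powR pnatr_eq0 /= -expRD; congr expR; field.
Qed.

End theta.

Theorem theorem2p7 (R : realType) :
  exists theta : {lrmorphism H1 -> R | (@ratr R) \; *%R},
    (forall a : H1, a \in H0 -> theta a = theta0 R a) /\
    power_series_at0
      (fun x : R => pi `^ (- 2^-1) * expR (- (euler_gamma R * x / 2))
                    * Gamma ((1 - x) / 2))
      (fun n => theta (h n)).
Proof.
have [theta th1 thw] := extension (ln 2) (mtv_nil R) (@mtv_mul R).
exists theta; split.
  move=> a /allP H0a; rewrite lrmorphism_ext theta0E.
  by apply: eq_ext => w /H0a /thw.
(* The even bound 2 (N + 1) makes the power sums of degree at least 2 those of 1, 1 / 3, ..., 1 / (2
   N + 1), while the value at z_1 is prescribed. *)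
have /choice [T TP] N : exists t : {lrmorphism H1 -> R | (@ratr R) \; *%R},
    t (of_word [:: z1]) = trunc_z1 R N /\
    forall k, (0 < k)%N ->
      t (of_word [:: letterS k]) = \sum_(0 <= j < N.+1) j.*2.+1%:R ^- k.+1.
  have [t t1 tw] := extension (trunc_z1 R N) (trunc_nil R N.+1.*2)
    (fun u v _ _ => trunc_mul R N.+1.*2 u v).
  by exists t; split=> // k k0; rewrite tw // trunc_letter.
pose p N k : R := T N (of_word [:: letterS k]).
have p0 N : p N 0%N = trunc_z1 R N by have [] := TP N.
have pS N k : p N k.+1 = \sum_(0 <= j < N.+1) j.*2.+1%:R ^- k.+2 by have [_ /(_ k.+1 isT)] := TP N.
have p_cvg k : p N k @[N --> \oo] --> theta (of_word [:: letterS k]).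
  case: k => [|k].
    by rewrite th1 (_ : p ^~ 0%N = trunc_z1 R); [exact: odd_harmonic_cvg|exact/funext].
  rewrite thw // (_ : p ^~ k.+1 = (fun N => \sum_(0 <= j < N.+1) j.*2.+1%:R ^- k.+2)).
    rewrite (cvg_shiftS (fun N => \sum_(0 <= j < N) j.*2.+1%:R ^- k.+2 : R)).
    exact: odd_zeta_cvg.
  exact/funext.
(* The bound is uniform in N and k: the sequences for k = 0 and k = 1 converge, and higher power
   sums are at most that of degree 2, the variables being at most 1. *)
have [B [B0 pB]] : exists B : R, 0 <= B /\ forall N k, `|p N k| <= B.
  have [B0 pB0] := bounded_of_cvg (p_cvg 0%N).
  have [B1 pB1] := bounded_of_cvg (p_cvg 1%N).
  have B0_ge0 : 0 <= B0 := le_trans (normr_ge0 _) (pB0 0%N).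
  have B1_ge0 : 0 <= B1 := le_trans (normr_ge0 _) (pB1 0%N).
  exists (B0 + B1); split=> [|N [|k]]; first exact: addr_ge0.
    by rewrite (le_trans (pB0 _)) // lerDl.
  apply: (@le_trans _ _ B1); last by rewrite lerDr.
  have p_ge0 M i : 0 <= p M i.+1.
    by rewrite pS sumr_ge0 // => j _; rewrite invr_ge0 exprn_ge0.
  apply: le_trans (pB1 N); rewrite !ger0_norm // !pS.
  apply: ler_sum_nat => j _; rewrite lef_pV2 ?posrE ?exprn_gt0 //.
  by rewrite ler_weXn2l ?ler1n.
have TB N n : `|T N (h n)| <= (1 + B) ^+ n.
  exact: (newton_bound (newton_lrmorphism (T N)) (pB N)).
have T_cvg n : T N (h n) @[N --> \oo] --> theta (h n).
  exact: (newton_cvg (fun N => newton_lrmorphism (T N)) (newton_lrmorphism theta) p_cvg).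
(* Within this radius the bound (1 + B) ^ n yields terms of size at most 2 ^ (- n), as [tannery]
   requires. *)
have K0 : 0 < (2 * (1 + B))^-1 by rewrite invr_gt0 mulr_gt0 // ltr_wpDr.
rewrite /power_series_at0; near=> x.
have xK : `|x| < (2 * (1 + B))^-1 by by near: x; apply: (@nbhs0_lt R R).
have xB : `|x| * (1 + B) <= 2^-1.
  by rewrite -ler_pdivlMr ?ltr_wpDr // -invfM ltW // mulrC.
have x1 : `|x| < 1.
  by rewrite (lt_le_trans xK) // invf_le1 ?mulr_gt0 ?ltr_wpDr //; lra.
have ub N n : `|T N (h n) * x ^+ n| <= 2^-1 ^+ n.
  rewrite normrM normrX mulrC (le_trans (ler_wpM2l (exprn_ge0 _ (normr_ge0 _)) (TB N n))) //.
  by rewrite -exprMn lerXn2r ?nnegrE ?mulr_ge0 ?addr_ge0.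
pose S N := expR (- ((ln N.+1%:R + euler_gamma R) / 2) * x) *
    \prod_(0 <= j < N.+1) (1 - x / j.*2.+1%:R)^-1.
have uS N : series (fun n => T N (h n) * x ^+ n) n @[n --> \oo] --> S N.
  have /cvg_ex [l ul] := is_cvg_series_half (ub N).
  rewrite (_ : S N = l) // /S.
  (* The power sums are those of the variables 1 / (2 j + 1), corrected by [d] in degree 1. *)
  have <- := newton_product (rs := [seq j.*2.+1%:R^-1 | j <- index_iota 0 N.+1])
    (d := - ((ln N.+1%:R + euler_gamma R) / 2)) (newton_lrmorphism (T N)) _ ul.
    (* The factors 1 - x / (2 j + 1) are positive as |x| < 1, so they cancel against their
       inverses. *)
    rewrite big_map -mulrA -big_split big1 ?mulr1 // => j _ /=.
    rewrite [_ * x]mulrC mulfV // gt_eqF // subr_gt0 (le_lt_trans (ler_norm _)) //.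
    rewrite normrM (le_lt_trans _ x1) // ler_piMr // normfV ger0_norm // invf_le1 // ler1n //.
  move=> k; rewrite big_map; case: k => [|k].
    by rewrite [LHS]p0 mulr1 /trunc_z1 addrC.
  by rewrite [LHS]pS mulr0 add0r; under [RHS]eq_bigr do rewrite exprVn.
(* Interchange the limit in N with the sum over n, then compare the two limits of [S]. *)
have [t tv St] := tannery ub (fun n => cvgM (T_cvg n) (cvg_cst _)) uS.
by rewrite -(cvg_unique _ St (gamma_product_cvg x1)).
Unshelve. all: by end_near. Qed.
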